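(* Every element of $V_4^0$ is magnetic; that is, for every $v\in V_4^0$ there is an integer $N>0$ such that $N\cdot\delta^{-1}v\in q\mathbb{Z}[[q]]$.
   Context: Let $q=e^{2\pi i\tau}$, $\delta=q\frac{d}{dq}$, and let $E_2=1-24\sum_{n\ge1}\frac{nq^n}{1-q^n}$, $E_4=1+240\sum_{n\ge1}\frac{n^3q^n}{1-q^n}$, $E_6=1-504\sum_{n\ge1}\frac{n^5q^n}{1-q^n}$, regarded as elements of $\mathbb{Z}[[q]]$ ($E_4,E_6$ are invertible there). For integers $a,b,c$ with $a\ge0$ put $f_{a,b,c}=E_2^aE_4^bE_6^c\in\mathbb{Z}[[q]]$; its weight is $2a+4b+6c$. For even $k$, let $W_k\subset\mathbb{Q}[[q]]$ be the $\mathbb{Q}$-span of all $f_{a,b,c}$ of weight $k$, and $W_k^0$ the subspace of elements with zero constant term. Let $V_k$ be the $\mathbb{Q}$-span of the $f_{a,b,c}$ of weight $k$ with $a\in\{0,1,\dots,k-2\}$, and $V_k^0=V_k\cap W_k^0$. For $v=\sum_{n\ge1}c_nq^n\in W_k^0$ put $\delta^{-1}v=\sum_{n\ge1}\frac{c_n}{n}q^n$; $v$ is called magnetic if $\delta^{-1}v\in\mathbb{Q}\otimes_{\mathbb{Z}}q\mathbb{Z}[[q]]$, i.e. $N\delta^{-1}v\in q\mathbb{Z}[[q]]$ for some integer $N>0$. *)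

(* Defs.v *)
From HB Require Import structures.
From mathcomp Require Import all_boot all_order all_algebra.
From mathcomp Require Import boolp classical_sets.

Set Implicit Arguments.
Unset Strict Implicit.
Unset Printing Implicit Defensive.

Import Order.TTheory GRing.Theory Num.Theory.
Local Open Scope classical_set_scope.
Local Open Scope ring_scope.

Record fps (R : Type) := Fps { coefs : nat -> R }.
Add Printing Constructor fps.

Notation "{ 'fps' R }" := (fps R) (format "{ 'fps'  R }") : type_scope.

Lemma fpsP (R : Type) (x y : {fps R}) :
  (forall n, coefs x n = coefs y n) -> x = y.
Proof. by case: x y => [f] [g] /= /funext ->. Qed.

HB.instance Definition _ (R : Type) := gen_eqMixin {fps R}.
HB.instance Definition _ (R : Type) := gen_choiceMixin {fps R}.

Definition fps_map (R S : Type) (h : R -> S) (x : {fps R}) : {fps S} :=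
  Fps (fun n => h (coefs x n)).

Section Zmodule.
Variable R : zmodType.
Implicit Types x y z : {fps R}.

Definition fps_zero : {fps R} := Fps (fun _ => 0).
Definition fps_opp x : {fps R} := Fps (fun n => - coefs x n).
Definition fps_add x y : {fps R} := Fps (fun n => coefs x n + coefs y n).

Fact fps_addA : associative fps_add.
Proof. by move=> x y z; apply: fpsP => n; rewrite /= addrA. Qed.
Fact fps_addC : commutative fps_add.
Proof. by move=> x y; apply: fpsP => n; rewrite /= addrC. Qed.
Fact fps_add0 : left_id fps_zero fps_add.
Proof. by move=> x; apply: fpsP => n; rewrite /= add0r. Qed.
Fact fps_addN : left_inverse fps_zero fps_opp fps_add.
Proof. by move=> x; apply: fpsP => n; rewrite /= addNr. Qed.

HB.instance Definition _ :=
  GRing.isZmodule.Build {fps R} fps_addA fps_addC fps_add0 fps_addN.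

Lemma coefs0 n : coefs (0 : {fps R}) n = 0. Proof. by []. Qed.
Lemma coefsN x n : coefs (- x) n = - coefs x n. Proof. by []. Qed.
Lemma coefsD x y n : coefs (x + y) n = coefs x n + coefs y n.
Proof. by []. Qed.
Lemma coefsB x y n : coefs (x - y) n = coefs x n - coefs y n.
Proof. by []. Qed.
Lemma coefs_sum (I : Type) (r : seq I) (P : pred I) (F : I -> {fps R}) n :
  coefs (\sum_(i <- r | P i) F i) n = \sum_(i <- r | P i) coefs (F i) n.
Proof. by elim/big_rec2: _ => // i _ y _ <-. Qed.

(* The infinite sum of the F i, provided F i has no term of degree < i: the
   summands with i > n then do not contribute to the coefficient of q^n. *)
Definition fps_sum (F : nat -> {fps R}) : {fps R} :=
  Fps (fun n => \sum_(i < n.+1) coefs (F i) n).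

End Zmodule.

Section Ring.
Variable R : comNzRingType.
Implicit Types x y z : {fps R}.

Definition fps_one : {fps R} := Fps (fun n => (n == 0%N)%:R).
Definition fps_mul x y : {fps R} :=
  Fps (fun n => \sum_(i < n.+1) coefs x i * coefs y (n - i)%N).

Let trunc N x : {poly R} := \poly_(i < N.+1) coefs x i.

Let truncE N x n : (n <= N)%N -> coefs x n = (trunc N x)`_n.
Proof. by move=> le_nN; rewrite coef_poly ltnS le_nN. Qed.

Let trunc_mul N x y n :
  (n <= N)%N -> coefs (fps_mul x y) n = (trunc N x * trunc N y)`_n.
Proof.
move=> le_nN; rewrite coefM; apply: eq_bigr => i _.
have le_in : (i <= n)%N by rewrite -ltnS.
by rewrite -!truncE ?(leq_trans _ le_nN) ?leq_subr.
Qed.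

Fact fps_mulC : commutative fps_mul.
Proof. by move=> x y; apply: fpsP => n; rewrite !(trunc_mul _ _ (leqnn n)) mulrC. Qed.
Fact fps_mulA : associative fps_mul.
Proof.
move=> x y z; apply: fpsP => n.
transitivity (trunc n x * (trunc n y * trunc n z))`_n.
  rewrite coefM; apply: eq_bigr => i _; have le_in : (i <= n)%N by rewrite -ltnS.
  by rewrite -truncE // -trunc_mul ?leq_subr.
rewrite mulrA coefM; apply: eq_bigr => i _.
have le_in : (i <= n)%N by rewrite -ltnS.
by rewrite -truncE ?leq_subr // -trunc_mul.
Qed.
Fact fps_mul1 : left_id fps_one fps_mul.
Proof.
move=> x; apply: fpsP => n.
by rewrite /= big_ord_recl big1 /= ?subn0 ?mul1r ?addr0 // => i _; rewrite mul0r.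
Qed.
Fact fps_mulDl : left_distributive fps_mul +%R.
Proof.
move=> x y z; apply: fpsP => n; rewrite /= -big_split.
by apply: eq_bigr => i _; rewrite mulrDl.
Qed.
Fact fps_oner_neq0 : fps_one != 0.
Proof.
by apply/eqP => /(congr1 (fun x => coefs x 0)) /eqP; rewrite /= oner_eq0.
Qed.

HB.instance Definition _ := GRing.Zmodule_isComNzRing.Build {fps R}
  fps_mulA fps_mulC fps_mul1 fps_mulDl fps_oner_neq0.

Definition fps_scale (a : R) x : {fps R} := Fps (fun n => a * coefs x n).

Fact fps_scaleA a b x : fps_scale a (fps_scale b x) = fps_scale (a * b) x.
Proof. by apply: fpsP => n; rewrite /= mulrA. Qed.
Fact fps_scale1 : left_id 1 fps_scale.
Proof. by move=> x; apply: fpsP => n; rewrite /= mul1r. Qed.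
Fact fps_scaleDr : right_distributive fps_scale +%R.
Proof. by move=> a x y; apply: fpsP => n; rewrite /= mulrDr. Qed.
Fact fps_scaleDl x : {morph fps_scale^~ x : a b / a + b}.
Proof. by move=> a b; apply: fpsP => n; rewrite /= mulrDl. Qed.

HB.instance Definition _ := GRing.Zmodule_isLmodule.Build R {fps R}
  fps_scaleA fps_scale1 fps_scaleDr fps_scaleDl.

Fact fps_scaleAl (a : R) x y : a *: (x * y) = a *: x * y.
Proof.
by apply: fpsP => n; rewrite /= mulr_sumr; apply: eq_bigr => i _; rewrite mulrA.
Qed.

HB.instance Definition _ :=
  GRing.Lmodule_isLalgebra.Build R {fps R} fps_scaleAl.
HB.instance Definition _ := GRing.Lalgebra_isComAlgebra.Build R {fps R}.

Lemma coefs1 n : coefs (1 : {fps R}) n = (n == 0%N)%:R. Proof. by []. Qed.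
Lemma coefsM x y n :
  coefs (x * y) n = \sum_(i < n.+1) coefs x i * coefs y (n - i)%N.
Proof. by []. Qed.
Lemma coefsZ a x n : coefs (a *: x) n = a * coefs x n. Proof. by []. Qed.
Lemma coefsM0 x y : coefs (x * y) 0 = coefs x 0 * coefs y 0.
Proof. by rewrite coefsM big_ord_recl big_ord0 addr0. Qed.

Definition fps_q : {fps R} := Fps (fun n => (n == 1%N)%:R).

Lemma coefsX_lt x n m :
  coefs x 0 = 0 -> (m < n)%N -> coefs (x ^+ n) m = 0.
Proof.
move=> x0; elim: n m => // n IHn m lt_mn.
rewrite exprS coefsM big1 // => -[[|i] /= lt_im] _; first by rewrite x0 mul0r.
rewrite IHn ?mulr0 // (leq_trans _ (lt_mn : (m <= n)%N)) //.
by rewrite ltn_subrL /= (leq_trans _ (lt_im : (i < m)%N)).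
Qed.

Lemma coefs_mul_sum x (F : nat -> {fps R}) n :
    (forall i m, (m < i)%N -> coefs (F i) m = 0) ->
  coefs (x * fps_sum F) n = coefs (x * \sum_(i < n.+1) F i) n.
Proof.
move=> F0; rewrite !coefsM; apply: eq_bigr => i _; congr (_ * _).
rewrite coefs_sum /=; set m := (n - i)%N.
have le_mn : (m <= n)%N := leq_subr i n.
rewrite (big_ord_widen n.+1 (fun j => coefs (F j) m)) // big_mkcond /=.
by apply: eq_bigr => j _; case: ltnP => // lt_mj; rewrite F0.
Qed.

End Ring.

Section UnitRing.
Variable R : comUnitRingType.
Implicit Types x y z : {fps R}.

Definition fps_unit : {pred {fps R}} :=
  [pred x | coefs x 0 \is a GRing.unit].

(* With u the constant term of x, x^-1 = u^-1 sum_n (1 - u^-1 x)^n. *)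
Definition fps_inv x : {fps R} :=
  if x \in fps_unit then
    (coefs x 0)^-1 *: fps_sum (fun n => (1 - (coefs x 0)^-1 *: x) ^+ n)
  else x.

Fact fps_mulVr : {in fps_unit, left_inverse 1 fps_inv *%R}.
Proof.
move=> x Ux; rewrite /fps_inv Ux; move: Ux; rewrite inE; set u := coefs x 0 => Uu.
rewrite -scalerAl mulrC scalerAl; set y := u^-1 *: x.
have y0 : coefs (1 - y) 0 = 0 by rewrite coefsB coefsZ coefs1 /= mulVr // subrr.
apply: fpsP => n; rewrite coefs_mul_sum; last by move=> i m; apply: coefsX_lt.
have -> : y * \sum_(i < n.+1) (1 - y) ^+ i = 1 - (1 - y) ^+ n.+1.
  by rewrite -[RHS]opprB subrX1 -mulNr opprB subKr.
by rewrite coefsB coefsX_lt // subr0.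
Qed.
Fact fps_unitPl x y : y * x = 1 -> fps_unit x.
Proof.
move=> /(congr1 (fun z => coefs z 0)); rewrite coefsM0 coefs1 /= => yx1.
by apply/unitrPr; exists (coefs y 0); rewrite mulrC.
Qed.
Fact fps_inv_out : {in [predC fps_unit], fps_inv =1 id}.
Proof. by move=> x /negbTE Ux; rewrite /fps_inv Ux. Qed.

HB.instance Definition _ := GRing.ComNzRing_hasMulInverse.Build {fps R}
  fps_mulVr fps_unitPl fps_inv_out.

Lemma fps_unitE x : (x \is a GRing.unit) = (coefs x 0 \is a GRing.unit).
Proof. by []. Qed.

End UnitRing.

Definition lspan (K : pzRingType) (U : lmodType K) (S : set U) : set U :=
  [set v | exists2 s : seq (K * U), (forall t, t \in s -> S t.2)
                                  & v = \sum_(t <- s) t.1 *: t.2].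

Definition lambert (k : nat) : {fps int} :=
  fps_sum (fun i => let n := i.+1 in
    n%:R ^+ k * fps_q int ^+ n / (1 - fps_q int ^+ n)).

Definition E2 : {fps int} := 1 - 24 * lambert 1.
Definition E4 : {fps int} := 1 + 240 * lambert 3.
Definition E6 : {fps int} := 1 - 504 * lambert 5.

Lemma lambert0 k : coefs (lambert k) 0 = 0.
Proof.
rewrite [LHS]big_ord_recl big_ord0 addr0 !coefsM0 expr1.
by rewrite [coefs (fps_q int) 0]/= mulr0 mul0r.
Qed.

Lemma E4_unit : E4 \is a GRing.unit.
Proof. by rewrite fps_unitE coefsD coefsM0 lambert0 mulr0. Qed.

Lemma E6_unit : E6 \is a GRing.unit.
Proof. by rewrite fps_unitE coefsB coefsM0 lambert0 mulr0. Qed.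

Definition eis (a : nat) (b c : int) : {fps int} := E2 ^+ a * E4 ^ b * E6 ^ c.

Definition weight (a : nat) (b c : int) : int := 2 * a%:Z + 4 * b + 6 * c.

Definition fpsQ (x : {fps int}) : {fps rat} := fps_map intr x.

Definition W (k : int) : set {fps rat} :=
  lspan [set v | exists a b c, weight a b c = k /\ v = fpsQ (eis a b c)].

Definition W0 (k : int) : set {fps rat} := W k `&` [set v | coefs v 0 = 0].

Definition V (k : int) : set {fps rat} :=
  lspan [set v | exists a b c, [/\ weight a b c = k, a%:Z <= k - 2
                                 & v = fpsQ (eis a b c)]].

Definition V0 (k : int) : set {fps rat} := V k `&` W0 k.

(* Inverse of q d/dq; only meaningful on series with zero constant term. *)
Definition delta_inv (v : {fps rat}) : {fps rat} :=
  Fps (fun n => if n == 0%N then 0 else coefs v n / n%:R).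

Definition qZq : set {fps rat} :=
  [set v | exists2 w : {fps int}, coefs w 0 = 0 & v = fpsQ w].

Definition magnetic (v : {fps rat}) : Prop :=
  exists2 N : int, 0 < N & qZq (N%:~R *: delta_inv v).

(* Main.v *)
(* Idea. With r = E6/E4 and s = E4^2/E6, the derivatives of g, E2 f and E2^2 h
   (g, f, h monomials in E4, E6) reduce an element of V_4 modulo exact
   derivatives to a combination of tau_m = E4^(1+3m) / E6^(2m), and Bol's
   identity (the third derivative of a form of weight -2 is modular) reduces
   these to E4, Delta/E4^2 and E4 Delta/E6^2.  Ramanujan's differential
   equations, used throughout, follow from the partial fraction identity
   Q_a Q_b = Q_(a+b) (1 + Q_a + Q_b) for Q_a = q^a / (1 - q^a).

   Let y in qZ[[q]] solve y (1 - 432 y) = Delta/E4^3.  Then sqrt E4 = G(y)^2 for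
   the hypergeometric series G = 2F1(1/6, 5/6; 1; 432 y), and the two remaining
   forms are G(y)^2 dy and G(y)^2 dy / (1 - 864 y)^2.  Now G is the Legendre
   function P_n (1 - 864 y) at n = -1/6.  For a natural number n the
   antiderivatives of P_n^2 and P_n(X)^2 / X^2 are explicit, with denominator
   2n + 1 at worst; letting n approach -1/6 modulo suitable integers prime to 6
   bounds the denominators away from 6, and at 2 and 3 the factors 12^k in
   the coefficients of G suffice. *)
From HB Require Import structures.
Require Import Defs.
From mathcomp Require Import all_boot all_order all_algebra.
From mathcomp Require Import boolp classical_sets.
From mathcomp Require Import ring zify.

Set Implicit Arguments.
Unset Strict Implicit.
Unset Printing Implicit Defensive.

Import Order.TTheory GRing.Theory Num.Theory.
Local Open Scope ring_scope.

(** * Calculus of formal power series *)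

(** Leaves a pure [ring] goal once the cofactor [k] of a known equation is supplied; most
    computations below are certificates of this kind. *)
Lemma linear_comb (R : comNzRingType) (k l r a b : R) :
  a = b -> l - r = k * (a - b) -> l = r.
Proof. by move=> -> /eqP; rewrite subrr mulr0 subr_eq0 => /eqP. Qed.

Lemma linear_comb2 (R : comNzRingType) (k1 k2 l r a1 b1 a2 b2 : R) :
  a1 = b1 -> a2 = b2 -> l - r = k1 * (a1 - b1) + k2 * (a2 - b2) -> l = r.
Proof.
by move=> -> -> /eqP; rewrite !subrr !mulr0 addr0 subr_eq0 => /eqP.
Qed.

Section Calculus.
Variable R : comNzRingType.
Implicit Types (x y z f g : {fps R}) (n : nat).
Local Notation q := (fps_q R).

Definition fps_delta x : {fps R} := Fps (fun n => n%:R * coefs x n).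
Definition fps_deriv x : {fps R} := Fps (fun n => n.+1%:R * coefs x n.+1).
Definition fps_shift x : {fps R} := Fps (fun n => coefs x n.+1).

Lemma coefs_delta x n : coefs (fps_delta x) n = n%:R * coefs x n.
Proof. by []. Qed.

Lemma coefs_deriv x n : coefs (fps_deriv x) n = n.+1%:R * coefs x n.+1.
Proof. by []. Qed.

Lemma coefs_qM0 x : coefs (q * x) 0 = 0.
Proof. by rewrite coefsM0 mul0r. Qed.

Lemma coefs_qMS x n : coefs (q * x) n.+1 = coefs x n.
Proof.
rewrite coefsM !big_ord_recl /= mul0r add0r mul1r big1 ?addr0 => [|i _].
  by rewrite subSS subn0.
by rewrite mul0r.
Qed.

Lemma fps_qI : injective ( *%R q).
Proof. by move=> x y eq_qxy; apply: fpsP => n; rewrite -coefs_qMS eq_qxy coefs_qMS. Qed.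

Lemma fps_split x : x = coefs x 0 *: 1 + q * fps_shift x.
Proof.
apply: fpsP => -[|n]; rewrite coefsD coefsZ ?coefs_qM0 ?coefs_qMS coefs1 /=.
  by rewrite mulr1 addr0.
by rewrite mulr0 add0r.
Qed.

Lemma fps_shiftM f g : f * g = coefs f 0 *: g + q * (fps_shift f * g).
Proof. by rewrite {1}[f]fps_split mulrDl -scalerAl mul1r mulrA. Qed.

Fact fps_delta_is_zmod_morphism : zmod_morphism fps_delta.
Proof. by move=> x y; apply: fpsP => n /=; rewrite mulrBr. Qed.
HB.instance Definition _ :=
  GRing.isZmodMorphism.Build {fps R} {fps R} fps_delta fps_delta_is_zmod_morphism.

Lemma deltaD x y : fps_delta (x + y) = fps_delta x + fps_delta y.
Proof. exact: raddfD. Qed.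

Lemma deltaN x : fps_delta (- x) = - fps_delta x.
Proof. exact: raddfN. Qed.

Lemma deltaB x y : fps_delta (x - y) = fps_delta x - fps_delta y.
Proof. exact: raddfB. Qed.

Lemma delta1 : fps_delta 1 = 0.
Proof. by apply: fpsP => -[|n]; rewrite /= ?mul0r ?mulr0. Qed.

Lemma deltaM x y : fps_delta (x * y) = fps_delta x * y + x * fps_delta y.
Proof.
apply: fpsP => n; rewrite coefsD !coefsM -big_split /= mulr_sumr.
apply: eq_bigr => i _; have le_in : (i <= n)%N by rewrite -ltnS.
by rewrite -{1}(subnKC le_in) natrD /=; ring.
Qed.

Lemma delta_nat m : fps_delta m%:R = 0.
Proof. by rewrite raddfMn /= delta1 mul0rn. Qed.

Lemma delta_int (m : int) : fps_delta m%:~R = 0.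
Proof. by rewrite raddfMz /= delta1 mul0rz. Qed.

Lemma delta_natM m x : fps_delta (m%:R * x) = m%:R * fps_delta x.
Proof. by rewrite deltaM delta_nat mul0r add0r. Qed.

Lemma delta_intM (m : int) x : fps_delta (m%:~R * x) = m%:~R * fps_delta x.
Proof. by rewrite deltaM delta_int mul0r add0r. Qed.

Lemma deltaZ c x : fps_delta (c *: x) = c *: fps_delta x.
Proof. by apply: fpsP => n /=; ring. Qed.

Lemma delta_deriv x : fps_delta x = q * fps_deriv x.
Proof.
by apply: fpsP => -[|n]; rewrite ?coefs_qM0 ?coefs_qMS //= mul0r.
Qed.

Fact fps_deriv_is_zmod_morphism : zmod_morphism fps_deriv.
Proof. by move=> x y; apply: fpsP => n /=; rewrite mulrBr. Qed.
HB.instance Definition _ :=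
  GRing.isZmodMorphism.Build {fps R} {fps R} fps_deriv fps_deriv_is_zmod_morphism.

Lemma fps_derivD x y : fps_deriv (x + y) = fps_deriv x + fps_deriv y.
Proof. exact: raddfD. Qed.

Lemma fps_derivB x y : fps_deriv (x - y) = fps_deriv x - fps_deriv y.
Proof. exact: raddfB. Qed.

Lemma fps_derivM x y : fps_deriv (x * y) = fps_deriv x * y + x * fps_deriv y.
Proof.
by apply: fps_qI; rewrite -delta_deriv deltaM !delta_deriv; ring.
Qed.

Lemma fps_deriv1 : fps_deriv 1 = 0.
Proof. by apply: fps_qI; rewrite -delta_deriv delta1 mulr0. Qed.

Lemma fps_deriv_natM m x : fps_deriv (m%:R * x) = m%:R * fps_deriv x.
Proof. by apply: fps_qI; rewrite -delta_deriv delta_natM delta_deriv; ring. Qed.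

Lemma deriv_q : fps_deriv q = 1.
Proof.
by apply: fpsP => -[|n] /=; rewrite ?mulr1 ?mulr0.
Qed.

Lemma deriv_shift x : fps_deriv x = fps_shift x + q * fps_deriv (fps_shift x).
Proof.
apply: fpsP => -[|n]; rewrite coefsD ?coefs_qM0 ?coefs_qMS /=.
  by rewrite mul1r addr0.
by rewrite -[n.+2]addn1 natrD; ring.
Qed.

(** Multiplication by [y] raises the order, so each coefficient of [u i - v i] depends only on lower
    coefficients at [next i] and vanishes by induction. With [next] the shift, identities about
    composition follow by peeling off constant terms. *)
Lemma fps_contraction (I : Type) (next : I -> I) (u v : I -> {fps R}) y :
    coefs y 0 = 0 ->
    (forall i, u i - v i = y * (u (next i) - v (next i))) ->
  forall i, u i = v i.
Proof.
move=> y0 uv i; apply/eqP; rewrite -subr_eq0; apply/eqP/fpsP => n.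
elim/ltn_ind: n i => n IHn i; rewrite uv coefsM big1 // => j _.
have [-> | j_gt0] := posnP j; first by rewrite y0 mul0r.
rewrite IHn ?coefs0 ?mulr0 // ltn_subrL j_gt0.
by rewrite (leq_trans j_gt0) // -ltnS.
Qed.

(** A true substitution only when [coefs y 0 = 0]: then [y ^+ n] has order at least n and the
    cut-off in [fps_sum] loses nothing. *)
Definition fps_comp f y := fps_sum (fun n => coefs f n *: y ^+ n).

Section Composition.
Variables (y : {fps R}) (y0 : coefs y 0 = 0).

Lemma comp_split f :
  fps_comp f y = coefs f 0 *: 1 + y * fps_comp (fps_shift f) y.
Proof.
apply: fpsP => n; rewrite coefsD coefs_mul_sum => [|i m lt_mi]; last first.
  by rewrite coefsZ coefsX_lt // mulr0.
rewrite /fps_comp [LHS]big_ord_recl expr0; congr (_ + _).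
rewrite mulr_sumr coefs_sum big_ord_recr -scalerAr -exprS coefsZ coefsX_lt //.
by rewrite mulr0 [RHS]addr0; apply: eq_bigr => i _; rewrite -scalerAr -exprS.
Qed.

Lemma compD f g : fps_comp (f + g) y = fps_comp f y + fps_comp g y.
Proof.
by apply: fpsP => n; rewrite /= -big_split; apply: eq_bigr => i _; rewrite /= mulrDl.
Qed.

Lemma compZ c f : fps_comp (c *: f) y = c *: fps_comp f y.
Proof.
by apply: fpsP => n; rewrite /= mulr_sumr; apply: eq_bigr => i _; rewrite /= mulrA.
Qed.

Lemma compB f g : fps_comp (f - g) y = fps_comp f y - fps_comp g y.
Proof. by rewrite -scaleN1r compD compZ scaleN1r. Qed.

Lemma comp_natM m f : fps_comp (m%:R * f) y = m%:R * fps_comp f y.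
Proof. by rewrite !mulr_natl -!scaler_nat compZ. Qed.

Lemma comp_qM f : fps_comp (q * f) y = y * fps_comp f y.
Proof.
rewrite comp_split coefs_qM0 scale0r add0r; congr (_ * fps_comp _ _).
by apply: fpsP => n; rewrite -[RHS]coefs_qMS.
Qed.

Lemma comp1 : fps_comp 1 y = 1.
Proof.
rewrite comp_split scale1r; have -> : fps_shift 1 = 0 *: 0 by apply: fpsP => n; rewrite /= mul0r.
by rewrite compZ scale0r mulr0 addr0.
Qed.

Lemma compM f g : fps_comp (f * g) y = fps_comp f y * fps_comp g y.
Proof.
move: f; apply: (fps_contraction (next := fps_shift) y0) => f.
by rewrite fps_shiftM compD compZ comp_qM [fps_comp f y]comp_split mulrDl -scalerAl mul1r; ring.
Qed.

Lemma delta_comp f : fps_delta (fps_comp f y) = fps_comp (fps_deriv f) y * fps_delta y.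
Proof.
move: f; apply: (fps_contraction (next := fps_shift) y0) => f.
rewrite deriv_shift compD comp_qM [fps_comp f y]comp_split deltaD deltaM.
by rewrite deltaZ delta1 scaler0; ring.
Qed.

End Composition.

End Calculus.

Lemma coefs_natM (R : comNzRingType) m (x : {fps R}) n :
  coefs (m%:R * x) n = m%:R * coefs x n.
Proof. by rewrite mulr_natl -scaler_nat coefsZ. Qed.

Lemma fps_sum_natM (R : comNzRingType) m (F : nat -> {fps R}) :
  fps_sum (fun i => m%:R * F i) = m%:R * fps_sum F.
Proof.
apply: fpsP => n; rewrite coefs_natM mulr_sumr.
by apply: eq_bigr => i _; rewrite coefs_natM.
Qed.

Lemma fps_sumD (R : comNzRingType) (F G : nat -> {fps R}) :
  fps_sum (fun i => F i + G i) = fps_sum F + fps_sum G.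
Proof. by apply: fpsP => n; rewrite /= big_split. Qed.

Lemma deltaX2 (R : comNzRingType) (x : {fps R}) :
  fps_delta (x ^+ 2) = 2 * x * fps_delta x.
Proof. by rewrite expr2 deltaM; ring. Qed.

Lemma deltaX3 (R : comNzRingType) (x : {fps R}) :
  fps_delta (x ^+ 3) = 3 * x ^+ 2 * fps_delta x.
Proof. by rewrite exprS deltaM deltaX2; ring. Qed.

Lemma derivX2 (R : comNzRingType) (x : {fps R}) :
  fps_deriv (x ^+ 2) = 2 * x * fps_deriv x.
Proof. by rewrite expr2 fps_derivM; ring. Qed.

(** * Congruences modulo powers of q *)

Definition eqm (R : comNzRingType) (N : nat) (x y : {fps R}) :=
  forall n, (n < N)%N -> coefs x n = coefs y n.

Section Truncation.
Variable R : comNzRingType.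
Implicit Types (x y z : {fps R}) (N : nat).

Lemma eqm_all x y : (forall N, eqm N x y) -> x = y.
Proof. by move=> xy; apply: fpsP => n; apply: (xy n.+1). Qed.

Lemma eqmD N x x' y y' : eqm N x x' -> eqm N y y' -> eqm N (x + y) (x' + y').
Proof. by move=> xx' yy' n ltnN; rewrite !coefsD xx' ?yy'. Qed.

Lemma eqmN N x y : eqm N x y -> eqm N (- x) (- y).
Proof. by move=> xy n lt_nN; rewrite !coefsN xy. Qed.

Lemma eqmM N x x' y y' : eqm N x x' -> eqm N y y' -> eqm N (x * y) (x' * y').
Proof.
move=> xx' yy' n lt_nN; rewrite !coefsM; apply: eq_bigr => i _.
have le_in : (i <= n)%N by rewrite -ltnS.
by rewrite xx' ?yy' ?(leq_ltn_trans _ lt_nN) ?leq_subr.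
Qed.

Lemma eqmMl N z x y : eqm N x y -> eqm N (z * x) (z * y).
Proof. exact: eqmM. Qed.

Lemma eqm_delta N x y : eqm N x y -> eqm N (fps_delta x) (fps_delta y).
Proof. by move=> xy n lt_nN /=; rewrite xy. Qed.

Lemma coefs_qXM_lt n m x : (m < n)%N -> coefs (fps_q R ^+ n * x) m = 0.
Proof.
move=> lt_mn; rewrite coefsM big1 // => i _.
by rewrite coefsX_lt ?mul0r // (leq_trans _ lt_mn).
Qed.

Lemma eqm_fps_sum N (F : nat -> {fps R}) :
    (forall i m, (m <= i)%N -> coefs (F i) m = 0) ->
  eqm N (fps_sum F) (\sum_(1 <= a < N) F a.-1).
Proof.
move=> F0 n lt_nN; rewrite coefs_sum /= big_ord_recr /= F0 // addr0.
rewrite big_add1 -(big_mkord xpredT (fun i => coefs (F i) n)) /=.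
have le_nN : (n <= N.-1)%N by case: N lt_nN.
rewrite (big_nat_widen _ _ _ _ _ le_nN) big_mkcond; apply: eq_bigr => i _.
by case: ltnP => // /F0 ->.
Qed.

End Truncation.

(** * Convolutions of Lambert series and Ramanujan's equations *)

(** The series Q_a. At a = 0 the denominator is zero and the value is the default 0, so the sums
    below start at 1. *)
Definition lam (a : nat) : {fps int} := fps_q int ^+ a / (1 - fps_q int ^+ a).

Lemma one_sub_qX_unit a :
  (0 < a)%N -> 1 - fps_q int ^+ a \is a GRing.unit.
Proof. by move=> a_gt0; rewrite fps_unitE coefsB coefsX_lt // subr0. Qed.

Lemma lam_def a : (0 < a)%N -> lam a * (1 - fps_q int ^+ a) = fps_q int ^+ a.
Proof. by move=> a_gt0; rewrite divrK ?one_sub_qX_unit. Qed.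

(* The generating function form of the bijections
   (a, b, x, y) -> (a, a + b, x - y, y) and (a + b, b, x, y - x) between the
   solutions of ax + by = n with x > y (resp. x < y) and those with b > a
   (resp. a > b). *)
Lemma lamM a b : (0 < a)%N -> (0 < b)%N ->
  lam a * lam b = lam (a + b) * (1 + lam a + lam b).
Proof.
move=> a_gt0 b_gt0; have ab_gt0 : (0 < a + b)%N by rewrite addn_gt0 a_gt0.
apply: (mulIr (one_sub_qX_unit a_gt0)); apply: (mulIr (one_sub_qX_unit b_gt0)).
apply: (mulIr (one_sub_qX_unit ab_gt0)).
have [[la lb] lab] := (lam_def a_gt0, lam_def b_gt0, lam_def ab_gt0).
transitivity (lam a * (1 - fps_q int ^+ a) * (lam b * (1 - fps_q int ^+ b))
              * (1 - fps_q int ^+ (a + b))); first by ring.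
rewrite la lb.
transitivity (lam (a + b) * (1 - fps_q int ^+ (a + b)) *
  ((1 - fps_q int ^+ a) * (1 - fps_q int ^+ b)
   + lam a * (1 - fps_q int ^+ a) * (1 - fps_q int ^+ b)
   + lam b * (1 - fps_q int ^+ b) * (1 - fps_q int ^+ a))); last by ring.
by rewrite la lb lab exprD; ring.
Qed.

(** Obtained by differentiating [lam_def]; it trades the squares of [lam a] for derivatives. *)
Lemma delta_lam a : (0 < a)%N ->
  fps_delta (lam a) = a%:R * (lam a + lam a ^+ 2).
Proof.
move=> a_gt0; apply: (mulIr (one_sub_qX_unit a_gt0)).
have dqa : fps_delta (fps_q int ^+ a) = a%:R * fps_q int ^+ a.
  have dq : fps_delta (fps_q int) = fps_q int.
    by rewrite delta_deriv deriv_q mulr1.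
  elim: a {a_gt0} => [|a IHa]; first by rewrite delta1 mul0r.
  by rewrite exprS deltaM IHa dq; ring.
have := congr1 (@fps_delta int) (lam_def a_gt0).
rewrite deltaM deltaB delta1 dqa => d_lam.
transitivity (a%:R * fps_q int ^+ a + a%:R * fps_q int ^+ a * lam a).
  by rewrite -{1}d_lam; ring.
transitivity (a%:R * (1 + lam a) * (lam a * (1 - fps_q int ^+ a))); last by ring.
by rewrite lam_def //; ring.
Qed.

Lemma coefs_lam_lt a m x : (m < a)%N -> coefs (lam a * x) m = 0.
Proof. by move=> lt_ma; rewrite /lam -mulrA coefs_qXM_lt. Qed.

Definition lambertN (N k : nat) : {fps int} :=
  \sum_(1 <= a < N) a%:R ^+ k * lam a.

Lemma lambertE k : lambert k = fps_sum (fun i => i.+1%:R ^+ k * lam i.+1).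
Proof. by congr fps_sum; apply/funext => i; rewrite /lam mulrA. Qed.

Lemma eqm_lambert N k : eqm N (lambert k) (lambertN N k).
Proof.
move=> n lt_nN; rewrite lambertE (eqm_fps_sum _ lt_nN) => [|i m le_mi]; last first.
  by rewrite mulrC coefs_lam_lt.
by congr (coefs _ n); apply: eq_big_nat => -[|a].
Qed.

(** The square is cut according to d = max(a, b): two edges, equal by symmetry, and a corner. *)
Lemma sum_symmetric (V : zmodType) (F : nat -> nat -> V) N :
    (forall a b, F a b = F b a) ->
  \sum_(1 <= a < N) \sum_(1 <= b < N) F a b =
  \sum_(1 <= d < N) ((\sum_(1 <= a < d) F a d) *+ 2 + F d d).
Proof.
move=> symF; elim: N => [|[|N] IHN]; [by rewrite !big_geq.. |].
rewrite [RHS]big_nat_recr //= -IHN big_nat_recr //= [in X in _ + X]big_nat_recr //=.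
under eq_bigr => a _ do rewrite big_nat_recr //=.
rewrite mulr2n big_split /= -!addrA; congr (_ + (_ + (_ + _))).
by apply: eq_bigr => a _; apply: symF.
Qed.

Lemma sum_antidiagonal (V : zmodType) (F : nat -> nat -> V) N :
  \sum_(1 <= a < N) \sum_(1 <= b < N | (a + b < N)%N) F a b =
  \sum_(1 <= d < N) \sum_(1 <= a < d) F a (d - a)%N.
Proof.
transitivity (\sum_(1 <= a < N) \sum_(1 <= d < N | (a < d)%N) F a (d - a)%N).
  apply: eq_big_nat => a /andP[a_gt0 lt_aN].
  transitivity (\sum_(1 <= b < N - a) F a b).
    rewrite [RHS](big_nat_widen _ _ _ _ _ (leq_subr a N)).
    by apply: eq_bigl => b; rewrite ltn_subRL.
  transitivity (\sum_(1 + a <= d < N) F a (d - a)%N); last first.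
    by rewrite (@big_nat_widenl _ _ _ (1 + a) 1).
  by rewrite big_addn; apply: eq_bigr => b _; rewrite addnK.
under eq_bigr => a _ do rewrite big_mkcond /=.
rewrite exchange_big_nat /=; apply: eq_big_nat => d /andP[d_gt0 lt_dN].
by rewrite -big_mkcond [RHS](big_nat_widen _ _ _ _ _ (ltnW lt_dN)).
Qed.

(** By [lamM], grouping the [phi] sum by d = a + b produces [lam d * (1 + lam a + lam b)]. Since
    [psi a (a + b) = phi a b], its quadratic terms are the off-diagonal part of the [psi] sum and
    cancel; the linear terms and the diagonal squares remain. *)
Lemma lam_convolution (phi psi : nat -> nat -> {fps int}) N :
    (forall a b, phi a b = phi b a) -> (forall a b, psi a b = psi b a) ->
    (forall a b, psi a (a + b)%N = phi a b) ->
  eqm N (\sum_(1 <= a < N) \sum_(1 <= b < N) (phi a b - psi a b) * (lam a * lam b))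
        (\sum_(1 <= d < N) ((\sum_(1 <= a < d) phi a (d - a)%N) * lam d
                            - psi d d * lam d ^+ 2)).
Proof.
move=> symphi sympsi psi_phi.
pose F a b := psi a b * (lam a * lam b).
have symF a b : F a b = F b a by rewrite /F sympsi [lam a * _]mulrC.
have -> : \sum_(1 <= a < N) \sum_(1 <= b < N) (phi a b - psi a b) * (lam a * lam b)
  = \sum_(1 <= a < N) \sum_(1 <= b < N) phi a b * (lam a * lam b)
    - \sum_(1 <= d < N) ((\sum_(1 <= a < d) F a d) *+ 2 + F d d).
  rewrite -sum_symmetric // -sumrB; apply: eq_bigr => a _.
  by rewrite -sumrB; apply: eq_bigr => b _; rewrite mulrBl.
have -> : \sum_(1 <= d < N) ((\sum_(1 <= a < d) phi a (d - a)%N) * lam d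
                            - psi d d * lam d ^+ 2)
  = \sum_(1 <= d < N) \sum_(1 <= a < d)
        phi a (d - a)%N * (lam (a + (d - a)) * (1 + lam a + lam (d - a)))
    - \sum_(1 <= d < N) ((\sum_(1 <= a < d) F a d) *+ 2 + F d d).
  rewrite -sumrB; apply: eq_big_nat => d _.
  have -> : \sum_(1 <= a < d)
      phi a (d - a)%N * (lam (a + (d - a)) * (1 + lam a + lam (d - a)))
    = (\sum_(1 <= a < d) phi a (d - a)%N) * lam d
      + \sum_(1 <= a < d) F a d + \sum_(1 <= a < d) F (d - a)%N d.
    rewrite mulr_suml -!big_split; apply: eq_big_nat => a /andP[_ lt_ad] /=.
    rewrite subnKC ?(ltnW lt_ad) // /F.
    have <- : psi a d = phi a (d - a)%N by rewrite -psi_phi subnKC // ltnW.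
    have <- : psi a d = psi (d - a)%N d.
      rewrite -{1}(subnKC (ltnW lt_ad)) psi_phi symphi -psi_phi subnK //.
      exact: ltnW.
    by ring.
  (* The reflection a -> d - a turns the second quadratic sum into the first. *)
  rewrite [X in _ + _ + X - _]big_nat_rev /=.
  have -> : \sum_(1 <= a < d) F (d - (1 + d - a.+1))%N d = \sum_(1 <= a < d) F a d.
    apply: eq_big_nat => a /andP[_ lt_ad]; congr (F _ d).
    by rewrite add1n subSS subKn // ltnW.
  by rewrite /F; ring.
apply: eqmD => //; 
rewrite -(sum_antidiagonal
  (fun a b => phi a b * (lam (a + b) * (1 + lam a + lam b)))).
move=> n lt_nN; rewrite !coefs_sum; apply: eq_big_nat => a /andP[a_gt0 _].
rewrite !coefs_sum [RHS]big_mkcond; apply: eq_big_nat => b /andP[b_gt0 _].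
(* Pairs with a + b >= N do not contribute: their product contains [lam (a + b)], of order at least
   N. *)
rewrite lamM //; case: ltnP => // le_Nab.
by rewrite mulrCA coefs_lam_lt // (leq_trans lt_nN).
Qed.

(* Eliminates the squares [lam d ^+ 2] left on the diagonal, when
   [psi d d = d * e d]. *)
Lemma lambert_convolution (phi psi : nat -> nat -> {fps int}) e N :
    (forall a b, phi a b = phi b a) -> (forall a b, psi a b = psi b a) ->
    (forall a b, psi a (a + b)%N = phi a b) ->
    (forall d, psi d d = d%:R * e d) ->
  eqm N (\sum_(1 <= a < N) \sum_(1 <= b < N) (phi a b - psi a b) * (lam a * lam b))
        (\sum_(1 <= d < N) ((\sum_(1 <= a < d) phi a (d - a)%N + d%:R * e d) * lam d
                            - e d * fps_delta (lam d))).
Proof.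
move=> symphi sympsi psi_phi psi_e n lt_nN.
rewrite (lam_convolution symphi sympsi psi_phi lt_nN); congr (coefs _ n).
apply: eq_big_nat => d /andP[d_gt0 _].
by rewrite psi_e delta_lam //; ring.
Qed.

Ltac eqm_lamberts := by do ?[
  apply: eqm_lambert | apply: eqmD | apply: eqmN | apply: eqmM | apply: eqm_delta].

(** [S m D] plays the closed form of c times the sum of P(a, D - a) over 1 <= a <= m, with [c]
    clearing its denominators. Keeping D apart from m makes the telescoping step a polynomial
    identity. *)
Lemma sum_antidiagonal_poly (P : {fps int} -> {fps int} -> {fps int})
    (S : {fps int} -> {fps int} -> {fps int}) (c : {fps int}) :
    (forall D, S 0 D = 0) ->
    (forall m D, S (m + 1) D = S m D + c * P (m + 1) (D - (m + 1))) ->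
  forall d, (0 < d)%N ->
    c * (\sum_(1 <= a < d) P a%:R (d - a)%:R) = S (d%:R - 1) d%:R.
Proof.
move=> S0 SS d d_gt0.
have -> : \sum_(1 <= a < d) P a%:R (d - a)%:R = \sum_(1 <= a < d) P a%:R (d%:R - a%:R).
  by apply: eq_big_nat => a /andP[_ lt_ad]; rewrite natrB // ltnW.
have E m : c * (\sum_(1 <= a < m.+1) P a%:R (d%:R - a%:R)) = S m%:R d%:R.
  elim: m => [|m IHm]; first by rewrite big_geq // mulr0 S0.
  by rewrite big_nat_recr //= mulrDr IHm -natr1 SS.
by case: d d_gt0 E => // d _ ->; rewrite -natr1 addrK.
Qed.

Lemma polynomial_convolution (P S : {fps int} -> {fps int} -> {fps int})
    (E : {fps int} -> {fps int}) (c : {fps int}) :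
    (forall a b, P a b = P b a) -> (forall a b, P a (- b) = P b (- a)) ->
    (forall a b, P a (- (a + b)) = P a b) -> (forall d, P d (- d) = d * E d) ->
    (forall D, S 0 D = 0) ->
    (forall m D, S (m + 1) D = S m D + c * P (m + 1) (D - (m + 1))) ->
  forall N, eqm N
    (\sum_(1 <= a < N) \sum_(1 <= b < N)
       c * (P a%:R b%:R - P a%:R (- b%:R)) * (lam a * lam b))
    (\sum_(1 <= d < N)
       ((S (d%:R - 1) d%:R + c * (d%:R * E d%:R)) * lam d
        - c * E d%:R * fps_delta (lam d))).
Proof.
move=> symP symPN PN PE S0 SS N.
have -> : \sum_(1 <= a < N) \sum_(1 <= b < N)
       c * (P a%:R b%:R - P a%:R (- b%:R)) * (lam a * lam b) =
   c * \sum_(1 <= a < N) \sum_(1 <= b < N)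
       (P a%:R b%:R - P a%:R (- b%:R)) * (lam a * lam b).
  rewrite mulr_sumr; apply: eq_bigr => a _.
  by rewrite mulr_sumr; apply: eq_bigr => b _; ring.
have -> : \sum_(1 <= d < N)
       ((S (d%:R - 1) d%:R + c * (d%:R * E d%:R)) * lam d
        - c * E d%:R * fps_delta (lam d)) =
    c * \sum_(1 <= d < N)
       ((\sum_(1 <= a < d) P a%:R (d - a)%:R + d%:R * E d%:R) * lam d
        - E d%:R * fps_delta (lam d)).
  rewrite mulr_sumr; apply: eq_big_nat => d /andP[d_gt0 _].
  by rewrite -(sum_antidiagonal_poly S0 SS d_gt0); ring.
apply: eqmMl.
apply: (@lambert_convolution (fun a b => P a%:R b%:R) (fun a b => P a%:R (- b%:R))
  (fun d => E d%:R)) => [a b|a b|a b|d] //.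
by rewrite natrD.
Qed.

(** Each hypothesis is a polynomial identity within reach of [ring]: the [u]'s are the coefficients
    of the resulting sum as a polynomial in d, and [al], [be], [ga], [ep] those of the bilinear form
    in powers of a and b. *)
Lemma lambert_relation (P S : {fps int} -> {fps int} -> {fps int})
    (E : {fps int} -> {fps int}) (c u1 u3 u5 w al be ga ep : {fps int}) (k : nat) :
    (forall a b, P a b = P b a) -> (forall a b, P a (- b) = P b (- a)) ->
    (forall a b, P a (- (a + b)) = P a b) -> (forall d, P d (- d) = d * E d) ->
    (forall D, S 0 D = 0) ->
    (forall m D, S (m + 1) D = S m D + c * P (m + 1) (D - (m + 1))) ->
    (forall d, S (d - 1) d + c * (d * E d) = u1 * d + u3 * d ^+ 3 + u5 * d ^+ 5) ->
    (forall d, c * E d = w * d ^+ k) ->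
    (forall a b, c * (P a b - P a (- b)) =
       al * (a * b) + be * (a * b ^+ 3 + a ^+ 3 * b)
       + ga * (a * b ^+ 5 + a ^+ 5 * b) + ep * (a ^+ 3 * b ^+ 3)) ->
  al * (lambert 1 * lambert 1)
  + be * (lambert 1 * lambert 3 + lambert 3 * lambert 1)
  + ga * (lambert 1 * lambert 5 + lambert 5 * lambert 1)
  + ep * (lambert 3 * lambert 3) =
  u1 * lambert 1 + u3 * lambert 3 + u5 * lambert 5 - w * fps_delta (lambert k).
Proof.
move=> symP symPN PN PE S0 SS Su Ew Pab; apply: eqm_all => N n lt_nN.
transitivity (coefs (al * (lambertN N 1 * lambertN N 1)
  + be * (lambertN N 1 * lambertN N 3 + lambertN N 3 * lambertN N 1)
  + ga * (lambertN N 1 * lambertN N 5 + lambertN N 5 * lambertN N 1)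
  + ep * (lambertN N 3 * lambertN N 3)) n).
  by move: n lt_nN; eqm_lamberts.
transitivity (coefs (u1 * lambertN N 1 + u3 * lambertN N 3 + u5 * lambertN N 5
    - w * fps_delta (lambertN N k)) n); last first.
  by apply/esym; move: n lt_nN; eqm_lamberts.
have := polynomial_convolution symP symPN PN PE S0 SS lt_nN.
congr (_ = _); congr (coefs _ n).
  rewrite /lambertN !big_distrlr /= -!big_split !mulr_sumr -!big_split.
  apply: eq_bigr => a _ /=; rewrite -!big_split !mulr_sumr -!big_split.
  by apply: eq_bigr => b _ /=; rewrite Pab expr1; ring.
rewrite /lambertN raddf_sum !mulr_sumr -!sumrN -!big_split.
apply: eq_bigr => d _ /=.
by rewrite Su Ew -[_ ^+ k]natrX delta_natM natrX expr1; ring.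
Qed.

(** The polynomials [P] of this and the next two relations are built from a^2 + ab + b^2 and (ab(a +
    b))^2, both fixed by swapping a and b and by b -> -(a + b), as the convolution requires. *)
Lemma lambert1_sqr :
  12 * lambert 1 ^+ 2 =
  5 * lambert 3 + lambert 1 - 6 * fps_delta (lambert 1).
Proof.
pose P (a b : {fps int}) := a ^+ 2 + a * b + b ^+ 2.
pose S (m D : {fps int}) :=
  2 * m ^+ 3 - 3 * m ^+ 2 * D + 3 * m ^+ 2 + 6 * m * D ^+ 2 - 3 * m * D + m.
apply: (etrans _ (etrans (@lambert_relation P S (fun d => d)
  6 1 5 0 6 12 0 0 0 1 _ _ _ _ _ _ _ _ _) _)) => *; rewrite /S /P; ring.
Qed.

Lemma lambert1M3 :
  240 * (lambert 1 * lambert 3) =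
  21 * lambert 5 + 10 * lambert 3 - lambert 1 - 30 * fps_delta (lambert 3).
Proof.
pose P (a b : {fps int}) := (a ^+ 2 + a * b + b ^+ 2) ^+ 2.
pose S (m D : {fps int}) :=
  6 * m ^+ 5 - 15 * m ^+ 4 * D + 15 * m ^+ 4 + 30 * m ^+ 3 * D ^+ 2
    - 30 * m ^+ 3 * D + 10 * m ^+ 3 - 30 * m ^+ 2 * D ^+ 3
    + 45 * m ^+ 2 * D ^+ 2 - 15 * m ^+ 2 * D + 30 * m * D ^+ 4
    - 30 * m * D ^+ 3 + 15 * m * D ^+ 2 - m.
apply: (etrans _ (etrans (@lambert_relation P S (fun d => d ^+ 3)
  30 (-1) 10 21 30 0 120 0 0 3 _ _ _ _ _ _ _ _ _) _)) => *; rewrite /S /P; ring.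
Qed.

(* The coefficients 14 and -249 are those for which [lambert 7] drops out. *)
Lemma lambert1M5 :
  1008 * (lambert 1 * lambert 5) - 4800 * lambert 3 ^+ 2 =
  42 * lambert 5 + 40 * lambert 3 + 2 * lambert 1 - 84 * fps_delta (lambert 5).
Proof.
pose P (a b : {fps int}) := 14 * (a ^+ 2 + a * b + b ^+ 2) ^+ 3 - 249 * (a * b * (a + b)) ^+ 2.
pose S (m D : {fps int}) :=
  12 * m ^+ 7 - 42 * m ^+ 6 * D + 42 * m ^+ 6 - 198 * m ^+ 5 * D ^+ 2
    - 126 * m ^+ 5 * D + 42 * m ^+ 5 + 600 * m ^+ 4 * D ^+ 3
    - 495 * m ^+ 4 * D ^+ 2 - 105 * m ^+ 4 * D - 330 * m ^+ 3 * D ^+ 4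
    + 1200 * m ^+ 3 * D ^+ 3 - 330 * m ^+ 3 * D ^+ 2 - 14 * m ^+ 3
    - 126 * m ^+ 2 * D ^+ 5 - 495 * m ^+ 2 * D ^+ 4 + 600 * m ^+ 2 * D ^+ 3
    + 21 * m ^+ 2 * D + 84 * m * D ^+ 6 - 126 * m * D ^+ 5
    - 165 * m * D ^+ 4 + 33 * m * D ^+ 2 + 2 * m.
apply: (etrans _ (etrans (@lambert_relation P S (fun d => 14 * d ^+ 5)
  6 2 40 42 84 0 0 504 (-4800) 5 _ _ _ _ _ _ _ _ _) _)) => *; rewrite /S /P; ring.
Qed.

Lemma delta_E2 : 12 * fps_delta E2 = E2 ^+ 2 - E4.
Proof.
rewrite /E2 /E4 deltaB delta1 delta_natM.
by apply: (linear_comb (k := - 48) lambert1_sqr); ring.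
Qed.

Lemma delta_E4 : 3 * fps_delta E4 = E2 * E4 - E6.
Proof.
rewrite /E2 /E4 /E6 deltaD delta1 delta_natM.
by apply: (linear_comb (k := 24) lambert1M3); ring.
Qed.

Lemma delta_E6 : 2 * fps_delta E6 = E2 * E6 - E4 ^+ 2.
Proof.
rewrite /E2 /E4 /E6 deltaB delta1 delta_natM.
by apply: (linear_comb (k := - 12) lambert1M5); ring.
Qed.

Lemma fps_int_natI m : (0 < m)%N -> injective (fun x : {fps int} => m%:R * x).
Proof.
move=> m_gt0 x y /= eq_mxy; apply: fpsP => n.
have: coefs (m%:R * x) n = coefs (m%:R * y) n by rewrite eq_mxy.
by rewrite !coefs_natM => /mulfI; apply; rewrite pnatr_eq0 -lt0n.
Qed.

Lemma delta_invr (x : {fps int}) : x \is a GRing.unit ->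
  fps_delta x^-1 = - fps_delta x * x^-1 ^+ 2.
Proof.
move=> Ux; apply: (mulIr Ux).
have /eqP := congr1 (@fps_delta int) (mulVr Ux).
rewrite deltaM delta1 addr_eq0 => /eqP ->.
transitivity (- fps_delta x * x^-1 * (x^-1 * x)); last by ring.
by rewrite mulVr //; ring.
Qed.

(** * The discriminant and the parameter y *)

Lemma dvdn_12_cube_fifth d : (12 %| 5 * d ^ 3 + 7 * d ^ 5)%N.
Proof.
rewrite /dvdn -modnDm -modnMmr -[(7 * _ %% _)%N]modnMmr -modnXm -[(d ^ 5 %% _)%N]modnXm.
by have := ltn_pmod d (isT : 0 < 12)%N; move: (d %% 12)%N; do 12?[case => //].
Qed.

(** The linear part of E4^3 - E6^2 is 144 (5 [lambert 3] + 7 [lambert 5]), and 12 divides 5 d^3 + 7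
    d^5; the coefficients of the nonlinear terms are multiples of 1728. *)
Lemma disc_exists : exists D, 1728 * D = E4 ^+ 3 - E6 ^+ 2 /\ coefs D 0 = 0.
Proof.
pose K := fps_sum (fun i => ((5 * i.+1 ^ 3 + 7 * i.+1 ^ 5) %/ 12)%N%:R * lam i.+1).
have K12 : 12 * K = 5 * lambert 3 + 7 * lambert 5.
  rewrite !lambertE /K -!fps_sum_natM -fps_sumD; congr fps_sum; apply/funext => i.
  move: (i.+1) (lam i.+1) => d l; set c := (_ %/ 12)%N.
  have c12 : 12 * c%:R = 5 * d%:R ^+ 3 + 7 * d%:R ^+ 5 :> {fps int}.
    by rewrite -natrM mulnC divnK ?dvdn_12_cube_fifth // natrD natrM natrX natrM natrX.
  by apply: (linear_comb (k := l) c12); ring.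
exists (K + lambert 3 * (100 * lambert 3 + 20 ^+ 3 * lambert 3 ^+ 2)
        - lambert 5 * (147 * lambert 5)).
split; last first.
  rewrite coefsB coefsD !coefsM0 !lambert0 !mul0r addr0 subr0.
  rewrite [LHS]big_ord_recl big_ord0 addr0 coefs_natM.
  by rewrite -[lam 1]mulr1 coefs_lam_lt // mulr0.
by apply: (linear_comb (k := 144) K12); rewrite /E4 /E6; ring.
Qed.

(** The iterates of [F] from 0 stabilise coefficientwise; coefficient n is already final in iterate
    n + 1. *)
Lemma fps_fixpoint (F : {fps int} -> {fps int}) :
    (forall N x y, eqm N x y -> eqm N.+1 (F x) (F y)) ->
  exists z, z = F z.
Proof.
move=> contrF; pose u n := iter n F 0.
have u_stable n m : (n <= m)%N -> eqm n (u n) (u m).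
  by elim: n m => [|n IHn] [|m] // le_nm; apply/contrF/IHn.
pose z : {fps int} := Fps (fun n => coefs (u n.+1) n).
have zu n : eqm n z (u n) by move=> k lt_kn; apply: u_stable.
exists z; apply: fpsP => n.
by rewrite (zu n.+1) // (contrF n _ _ (zu n)).
Qed.

Lemma eqm_mul0 (R : comNzRingType) N (x y z : {fps R}) :
  coefs z 0 = 0 -> eqm N x y -> eqm N.+1 (z * x) (z * y).
Proof.
move=> z0 xy n le_nN; rewrite !coefsM; apply: eq_bigr => i _.
have [-> | i_gt0] := posnP i; first by rewrite z0 !mul0r.
have le_in : (i <= n)%N by rewrite -ltnS.
by rewrite xy // (leq_trans _ (le_nN : (n <= N)%N)) // ltn_subrL i_gt0 (leq_trans i_gt0).
Qed.

Lemma quadratic_exists (x : {fps int}) : coefs x 0 = 0 ->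
  exists2 y, coefs y 0 = 0 & x = y * (1 - 432 * y).
Proof.
(* Substituting y = x z and cancelling x gives this fixed-point equation, so y stays integral. *)
move=> x0; have [|z z_def] := @fps_fixpoint (fun z => 1 + x * (432 * z ^+ 2)).
  by move=> N a b ab; apply: eqmD => //; apply: eqm_mul0 => //; apply/eqmMl/eqmM.
exists (x * z); first by rewrite coefsM0 x0 mul0r.
by apply: (linear_comb (k := - x) z_def); ring.
Qed.

(** As [L] has no constant term, coefficient n of [e * L] involves only earlier coefficients of [e],
    which vanish by induction. *)
Lemma linear_ode_uniq m (e L : {fps int}) : (0 < m)%N ->
  coefs L 0 = 0 -> coefs e 0 = 0 -> m%:R * fps_delta e = e * L -> e = 0.
Proof.
move=> m_gt0 L0 e0 ode; apply: fpsP; elim/ltn_ind => -[|n] IHn //.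
have: coefs (m%:R * fps_delta e) n.+1 = coefs (e * L) n.+1 by rewrite ode.
rewrite coefs_natM coefsM big1 => [/eqP|i _].
  rewrite !mulf_eq0 !pnatr_eq0 -[m == _]leqn0 leqNgt m_gt0 /=.
  by move/eqP.
have [lt_in | le_ni] := ltnP i n.+1; first by rewrite IHn ?mul0r.
have -> : val i = n.+1 by apply/eqP; rewrite eqn_leq le_ni -ltnS ltn_ord.
by rewrite subnn L0 mulr0.
Qed.

Lemma coefs_inv0 (x y : {fps int}) : coefs x 0 = 1 -> x * y = 1 -> coefs y 0 = 1.
Proof.
by move=> x0 xy; have := coefsM0 x y; rewrite xy x0 mul1r => <-.
Qed.

Lemma coefsE40 : coefs E4 0 = 1.
Proof. by rewrite coefsD coefs_natM lambert0 mulr0. Qed.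

Lemma coefsE60 : coefs E6 0 = 1.
Proof. by rewrite coefsB coefs_natM lambert0 mulr0. Qed.

(* The square [h ^+ 2] of a solution of the hypergeometric equation and [H]
   agree because the "Wronskian" [2 * H * k - h * L] of [h] and of a formal
   square root of [H] satisfies a first order equation. *)
Lemma sqr_solution_uniq (x H L h k : {fps int}) :
    coefs H 0 = 1 -> coefs h 0 = 1 -> coefs k 0 = 0 -> coefs L 0 = 0 ->
    fps_delta H = L * H -> 2 * fps_delta L = L ^+ 2 + 240 * x * H ^+ 2 ->
    fps_delta h = H * k -> fps_delta k = 60 * x * H * h ->
  h ^+ 2 = H.
Proof.
move=> H0 h0 k0 L0 dH dL dh dk.
have w0 : 2 * H * k - h * L = 0.
  apply: (@linear_ode_uniq 2 _ L) => //.
    by rewrite coefsB !coefsM0 k0 L0 !mulr0 subr0.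
  rewrite deltaB deltaM delta_natM dH dk deltaM dh.
  by apply: (linear_comb (k := - h) dL); ring.
apply/eqP; rewrite -subr_eq0; apply/eqP; apply: (@linear_ode_uniq 1 _ L) => //.
  by rewrite coefsB expr2 coefsM0 h0 H0 mulr1 subrr.
rewrite deltaB deltaX2 dh dH.
by apply: (linear_comb (k := h) w0); ring.
Qed.

(* [y] is a Hauptmodul-like parameter in which [sqrt E4] is the square of
   [2F1(1/6, 5/6; 1; 432 y)], and [1 - 864 y = E6 / E4^(3/2)]. *)
Lemma modular_parametrization (g : {fps int}) :
    coefs g 0 = 1 ->
    fps_deriv (fps_q int * (1 - 432 * fps_q int) * fps_deriv g) = 60 * g ->
  exists D y, [/\ 1728 * D = E4 ^+ 3 - E6 ^+ 2, coefs y 0 = 0,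
    D * E4^-1 ^+ 2 = fps_comp (g ^+ 2) y * fps_delta y &
    (1 - 864 * y) ^+ 2 * (E4 * D * E6^-1 ^+ 2) = fps_comp (g ^+ 2) y * fps_delta y].
Proof.
move=> g0 ode_g; have [D [D_def D0]] := disc_exists.
have Hi : E4 * E4^-1 = 1 by rewrite mulrV ?E4_unit.
have Hj : E6 * E6^-1 = 1 by rewrite mulrV ?E6_unit.
have di := delta_invr E4_unit.
move: (E4^-1) (E6^-1) Hi Hj di => i j Hi Hj di.
have dD : fps_delta D = E2 * D.
  apply: (@fps_int_natI 1728) => //; rewrite -delta_natM D_def deltaB deltaX2 deltaX3.
  apply: (linear_comb2 (k1 := E4 ^+ 2) (k2 := - E6) delta_E4 delta_E6).
  have -> : 1728 * (E2 * D) = E2 * (1728 * D) by ring.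
  by rewrite D_def; ring.
(* This is 1/j. *)
pose x := D * i ^+ 3.
have x0 : coefs x 0 = 0 by rewrite coefsM0 D0 mul0r.
have Dx : D = x * E4 ^+ 3.
  have -> : x * E4 ^+ 3 = D * (E4 * i) ^+ 3 by rewrite /x; ring.
  by rewrite Hi expr1n mulr1.
have dx : fps_delta x = x * E6 * i.
  rewrite /x deltaM deltaX3 dD di.
  by apply: (linear_comb2 (k1 := - D * i ^+ 4) (k2 := - E2 * D * i ^+ 3) delta_E4 Hi); ring.
have [y y0 xy] := quadratic_exists x0.
pose s : {fps int} := 1 - 864 * y.
have s0 : coefs s 0 = 1 by rewrite coefsB coefs_natM y0 mulr0.
have Us : s \is a GRing.unit by rewrite fps_unitE s0.
have s2 : s ^+ 2 = 1 - 1728 * x by rewrite xy /s; ring.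
have E62 : E6 ^+ 2 = E4 ^+ 3 * s ^+ 2.
  rewrite s2; apply: (linear_comb2 (k1 := 1) (k2 := - 1728) D_def Dx); ring.
have Hs := mulrV Us; move: (s^-1) Hs => t Hs.
(* E6 / (s E4) is the square root of E4 with constant term 1, found without extracting a root
   because s^2 = 1 - 1728 x = E6^2 / E4^3. *)
pose H := E6 * t * i.
have H2 : H ^+ 2 = E4.
  have -> : H ^+ 2 = E6 ^+ 2 * t ^+ 2 * i ^+ 2 by rewrite /H; ring.
  rewrite E62; have -> : E4 ^+ 3 * s ^+ 2 * t ^+ 2 * i ^+ 2 =
    E4 * (E4 * i) ^+ 2 * (s * t) ^+ 2 by ring.
  by rewrite Hi Hs !expr1n !mulr1.
have Hsi : H * s = E6 * i.
  have -> : H * s = E6 * i * (s * t) by rewrite /H; ring.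
  by rewrite Hs mulr1.
have H3 : H ^+ 3 * s = E6.
  have -> : H ^+ 3 * s = H ^+ 2 * (H * s) by ring.
  by rewrite H2 Hsi mulrCA Hi mulr1.
have H0 : coefs H 0 = 1.
  by rewrite !coefsM0 coefsE60 (coefs_inv0 s0 Hs) (coefs_inv0 coefsE40 Hi) !mulr1.
have UH : H \is a GRing.unit by rewrite fps_unitE H0.
have dy : fps_delta y = x * H.
  apply: (mulrI Us).
  have -> : s * (x * H) = x * (H * s) by ring.
  rewrite Hsi mulrA -dx xy deltaM deltaB delta1 delta_natM /s; ring.
have dH : 6 * fps_delta H = E2 * H - H ^+ 2 * s.
  apply: (mulrI UH).
  have := delta_E4; rewrite -H2 deltaX2 -H3 => dH2.
  by apply: (linear_comb (k := 1) dH2); ring.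
have HH := mulrV UH; pose L := fps_delta H * H^-1.
have dHL : fps_delta H = L * H by rewrite /L -mulrA mulVr // mulr1.
have E2L : E2 = 6 * L + H * s.
  apply: (mulrI UH); have := dH; rewrite dHL => dH2.
  by apply: (linear_comb (k := - 1) dH2); ring.
have L0 : coefs L 0 = 0 by rewrite coefsM0 [coefs (fps_delta H) 0]mul0r mul0r.
have ds : fps_delta s = - (864 * (x * H)).
  by rewrite deltaB delta1 delta_natM dy sub0r.
(* With E2 = 6 L + H s, Ramanujan's equation for E2 becomes a Riccati equation for the logarithmic
   derivative L of H. *)
have dL : 2 * fps_delta L = L ^+ 2 + 240 * x * H ^+ 2.
  apply: (@fps_int_natI 36) => //.
  have := delta_E2; rewrite E2L -H2 deltaD delta_natM deltaM dHL ds => dE2.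
  by apply: (linear_comb2 (k1 := 1) (k2 := H ^+ 2) dE2 s2); ring.
(* Here k = y (1 - 432 y) g'(y), so the differential equation of [g] yields the derivative of k. *)
pose h := fps_comp g y; pose k := x * fps_comp (fps_deriv g) y.
have hH : h ^+ 2 = H.
  apply: (@sqr_solution_uniq x H L h k) => //.
  - by rewrite /h comp_split // coefsD coefsM0 y0 mul0r addr0 g0 scale1r.
  - by rewrite coefsM0 x0 mul0r.
  - by rewrite /h delta_comp // dy /k; ring.
  have -> : k = fps_comp (fps_q int * (1 - 432 * fps_q int) * fps_deriv g) y.
    have -> : fps_q int * (1 - 432 * fps_q int) * fps_deriv g =
      fps_q int * fps_deriv g - 432 * (fps_q int * (fps_q int * fps_deriv g)) by ring.
    by rewrite compB comp_natM !comp_qM // /k xy; ring.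
  by rewrite delta_comp // ode_g dy comp_natM /h; ring.
have gH : fps_comp (g ^+ 2) y = H by rewrite expr2 compM // -expr2.
exists D, y; rewrite gH dy; split => //.
  rewrite Dx.
  by apply: (linear_comb2 (k1 := x * E4 * (E4 * i + 1)) (k2 := - x) Hi H2); ring.
have -> : s ^+ 2 * (E4 * D * j ^+ 2) = x * E4 * (E4 ^+ 3 * s ^+ 2) * j ^+ 2.
  by rewrite Dx; ring.
rewrite -E62.
by apply: (linear_comb2 (k1 := x * E4 * (E6 * j + 1)) (k2 := - x) Hj H2); ring.
Qed.

(** * The hypergeometric series and Legendre polynomials *)

(** 36^k (1/6)_k (5/6)_k in Pochhammer symbols. *)
Definition hyp_num k := (\prod_(i < k) ((6 * i + 1) * (6 * i + 5)))%N.

(* The multinomial coefficient (6k)! / ((3k)! (2k)! k!). *)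
Definition hyp_coef k := ('C(6 * k, 3 * k) * 'C(3 * k, k))%N.

(** Among 6k + 1, ..., 6k + 6, the even factors are absorbed by (3k + 3)! and 6k + 3 by (2k + 2)!,
    leaving (6k + 1)(6k + 5) and a factor 12. *)
Lemma hyp_coefE k : (hyp_coef k * (k`! ^ 2) = 12 ^ k * hyp_num k)%N.
Proof.
have num_fact : ((6 * k)`! * k`! = 12 ^ k * hyp_num k * ((3 * k)`! * (2 * k)`!))%N.
  elim: k => [|k IHk]; first by rewrite /hyp_num big_ord0.
  rewrite /hyp_num big_ord_recr -/(hyp_num k) /= !mulnS !addSn !add0n !factS expnS.
  transitivity ((6 * k).+1 * (6 * k).+2 * (6 * k).+3 * (6 * k).+4 * (6 * k).+4.+1
    * (6 * k).+4.+2 * k.+1 * ((6 * k)`! * k`!))%N; first by ring.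
  by rewrite IHk; ring.
have F_gt0 : (0 < (3 * k)`! * (2 * k)`!)%N by rewrite muln_gt0 !fact_gt0.
apply/eqP; rewrite -(eqn_pmul2r F_gt0) -num_fact; apply/eqP.
have h1 := @bin_fact (6 * k) (3 * k) ltac:(lia).
have h2 := @bin_fact (3 * k) k ltac:(lia).
have e1 : (6 * k - 3 * k = 3 * k)%N by lia.
have e2 : (3 * k - k = 2 * k)%N by lia.
rewrite e1 in h1; rewrite e2 in h2.
by rewrite -h1 -{3}h2 /hyp_coef; ring.
Qed.

Lemma hyp_coefS k :
  (k.+1 ^ 2 * hyp_coef k.+1 = 12 * ((6 * k + 1) * (6 * k + 5)) * hyp_coef k)%N.
Proof.
have F_gt0 : (0 < k`! ^ 2)%N by rewrite expn_gt0 fact_gt0.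
apply/eqP; rewrite -(eqn_pmul2r F_gt0); apply/eqP.
rewrite -[RHS]mulnA hyp_coefE.
transitivity (hyp_coef k.+1 * (k.+1)`! ^ 2)%N; first by rewrite factS; ring.
by rewrite hyp_coefE /hyp_num big_ord_recr expnS /=; ring.
Qed.

Definition hyp_series : {fps int} := Fps (fun k => (hyp_coef k)%:R).

Lemma hyp_series0 : coefs hyp_series 0 = 1.
Proof. by []. Qed.

Lemma hyp_series_ode :
  fps_deriv (fps_q int * (1 - 432 * fps_q int) * fps_deriv hyp_series) = 60 * hyp_series.
Proof.
have -> : fps_q int * (1 - 432 * fps_q int) * fps_deriv hyp_series
  = fps_q int * (fps_deriv hyp_series - 432 * (fps_q int * fps_deriv hyp_series)) by ring.
rewrite -delta_deriv; apply: fpsP => n.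
rewrite coefs_deriv coefs_qMS coefsB !coefs_natM coefs_deriv coefs_delta.
have gE m : coefs hyp_series m = (hyp_coef m)%:R by [].
rewrite !gE.
have := congr1 (fun m => m%:R : int) (hyp_coefS n).
move: (hyp_coef n) (hyp_coef n.+1) => a b /= rec.
by apply: (linear_comb (k := 1) rec); ring.
Qed.

(** The scaling by (n!)^2 clears hypergeometric denominators and is compatible with products, since
    n! = C(n, i) i! (n - i)!; the factor 12^n records divisibility at 2 and 3. *)
Definition scaled_dvd (d : int) (f : {fps int}) :=
  forall n, (d * 12 ^+ n %| (n`!)%:R ^+ 2 * coefs f n)%Z.

Lemma scaled_dvdD d f g : scaled_dvd d f -> scaled_dvd d g -> scaled_dvd d (f + g).
Proof. by move=> df dg n; rewrite coefsD mulrDr rpredD. Qed.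

Lemma scaled_dvdM d e f g :
  scaled_dvd d f -> scaled_dvd e g -> scaled_dvd (d * e) (f * g).
Proof.
move=> df eg n; rewrite coefsM mulr_sumr rpred_sum // => i _.
have le_in : (i <= n)%N by rewrite -ltnS.
rewrite -(bin_fact le_in) -[n in 12 ^+ n](subnKC le_in) exprD !natrM.
have -> : ('C(n, i)%:R * ((i`!)%:R * (n - i)`!%:R)) ^+ 2 * (coefs f i * coefs g (n - i))
  = 'C(n, i)%:R ^+ 2 * (((i`!)%:R ^+ 2 * coefs f i)
                        * (((n - i)`!)%:R ^+ 2 * coefs g (n - i))) :> int by ring.
by rewrite [d * e * _]mulrACA; apply/dvdz_mull/dvdz_mul; [apply: df | apply: eg].
Qed.

Lemma scaled_dvd_hyp : scaled_dvd 1 hyp_series.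
Proof.
move=> n; have := congr1 (fun m => m%:R : int) (hyp_coefE n).
have -> : coefs hyp_series n = (hyp_coef n)%:R by [].
move: (hyp_coef n) (hyp_num n) => a b /=; rewrite natrM natrX natrM natrX => ab; apply/dvdzP; exists b%:R.
by apply: (linear_comb (k := 1) ab); ring.
Qed.

(* [legendre n] is the Legendre polynomial [P_n (1 - 864 y)]; the hypergeometric
   series above is the specialisation [n = - 1/6]. *)
Definition legendre n : {fps int} :=
  Fps (fun k => (- 432) ^+ k * ('C(n + k, 2 * k) * 'C(2 * k, k))%:R).

(** Matches the shape of [hyp_coefE]: at n = -1/6 each factor becomes (6i + 1)(6i + 5). *)
Lemma legendre_scaled n k :
  (k`!)%:R ^+ 2 * coefs (legendre n) k =
  12 ^+ k * \prod_(i < k) (36 * ((i%:R - n%:R) * (i%:R + 1 + n%:R))) :> int.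
Proof.
have -> : (k`!)%:R ^+ 2 * coefs (legendre n) k
  = (- 432) ^+ k * ((n + k) ^_ (2 * k))%:R :> int.
  rewrite -bin_ffact -(@bin_fact (2 * k) k) ?leq_pmull //.
  have -> : (2 * k - k = k)%N by lia.
  by rewrite /= !natrM; ring.
elim: k => [|k IHk]; first by rewrite big_ord0 ffactn0.
rewrite big_ord_recr /= exprS [12 ^+ k.+1]exprS.
have -> : ((n + k.+1) ^_ (2 * k.+1))%:R
  = (n%:R + k%:R + 1) * ((n%:R - k%:R) * ((n + k) ^_ (2 * k))%:R) :> int.
  rewrite mulnS addnS ffactSS ffactnSr natrM -natr1 natrD natrM; congr (_ * _).
  have [le_kn | lt_nk] := leqP k n.
    by rewrite natrB; [rewrite natrD natrM; ring | lia].
  by rewrite ffact_small ?mul0r ?mulr0 //; lia.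
by apply: (linear_comb
  (k := - 432 * (n%:R + k%:R + 1) * (n%:R - k%:R)) IHk); ring.
Qed.

Lemma scaled_dvd_legendre n : scaled_dvd 1 (legendre n).
Proof. by move=> k; rewrite mul1r legendre_scaled dvdz_mulr. Qed.

(** Corresponding factors of the two products differ by (6n + 1)(6n + 5), hence agree modulo 6n +
    1. *)
Lemma scaled_dvd_hyp_legendre n :
  scaled_dvd (6 * n%:R + 1) (hyp_series - legendre n).
Proof.
move=> k; rewrite coefsB mulrBr legendre_scaled.
have -> : (k`!)%:R ^+ 2 * coefs hyp_series k
  = 12 ^+ k * \prod_(i < k) ((6 * i%:R + 1) * (6 * i%:R + 5)) :> int.
  have <- : (hyp_num k)%:R = \prod_(i < k) ((6 * i%:R + 1) * (6 * i%:R + 5)) :> int.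
    by rewrite natr_prod; apply: eq_bigr => i _; ring.
  have := congr1 (fun m => m%:R : int) (hyp_coefE k).
  have -> : coefs hyp_series k = (hyp_coef k)%:R by [].
  move: (hyp_coef k) (hyp_num k) => a b /=; rewrite natrM natrX natrM natrX => ab.
  by apply: (linear_comb (k := 1) ab); ring.
rewrite -mulrBr mulrC dvdz_mul //; elim: k => [|k IHk].
  by rewrite !big_ord0 subrr dvdz0.
rewrite !big_ord_recr /=; move: IHk.
set P := \prod_(i < k) _; set Q := \prod_(i < k) _ => IHk.
have -> : P * ((6 * k%:R + 1) * (6 * k%:R + 5))
    - Q * (36 * ((k%:R - n%:R) * (k%:R + 1 + n%:R)))
  = (P - Q) * ((6 * k%:R + 1) * (6 * k%:R + 5))
    + (6 * n%:R + 1) * ((6 * n%:R + 5) * Q) by ring.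
by rewrite rpredD // ?dvdz_mulr.
Qed.

(** * Legendre recurrences and antiderivatives of squares *)

Lemma legendre_bin_neighbour n k :
  (n.+1%:R - k%:R) * coefs (legendre n.+1) k
    = (n.+1%:R + k%:R) * coefs (legendre n) k :> int.
Proof.
have bin : ((n.+1 - k) * 'C(n.+1 + k, 2 * k) = (n.+1 + k) * 'C(n + k, 2 * k))%N.
  have := mul_bin_down (n.+1 + k) (2 * k); rewrite addSn /= -addSn => ->.
  by congr (_ * _)%N; lia.
have {bin} : (n.+1%:R - k%:R) * 'C(n.+1 + k, 2 * k)%:R
    = (n.+1%:R + k%:R) * 'C(n + k, 2 * k)%:R :> int.
  rewrite -natrD -natrM -bin natrM; have [le_kn | lt_nk] := leqP k n.+1.
    by rewrite natrB.
  by rewrite [('C(_, _))]bin_small ?mulr0 //; lia.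
have coefE m : coefs (legendre m) k
    = (- 432) ^+ k * ('C(m + k, 2 * k) * 'C(2 * k, k))%:R by [].
rewrite !coefE {coefE}.
move: ('C(_, _)) ('C(_, _)) ('C(_, _)) => a b c abc.
by apply: (linear_comb (k := (- 432) ^+ k * a%:R) abc); ring.
Qed.

Lemma central_binS k : (k.+1 * 'C(2 * k.+1, k.+1) = 2 * ((2 * k).+1 * 'C(2 * k, k)))%N.
Proof.
have -> : (2 * k.+1 = (2 * k).+2)%N by lia.
rewrite -(mul_bin_diag (2 * k).+2 k) /=.
have /= := mul_bin_down (2 * k).+1 k.
have -> : ((2 * k).+1 - k = k.+1)%N by lia.
by move=> ->; rewrite mulnA; congr (_ * _)%N; lia.
Qed.

Lemma legendre_deriv_sub n k :
  k.+1%:R * (coefs (legendre n.+1) k.+1 - coefs (legendre n) k.+1)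
    = - 864 * (n.+1%:R - k%:R) * coefs (legendre n.+1) k :> int.
Proof.
have bin1 : 'C(n.+1 + k.+1, 2 * k.+1)
    = ('C(n + k.+1, 2 * k.+1) + 'C(n.+1 + k, (2 * k).+1))%N.
  have -> : (2 * k.+1 = (2 * k).+2)%N by lia.
  by rewrite addSn binS addSnnS.
have bin2 : (2 * k%:R + 1) * 'C(n.+1 + k, (2 * k).+1)%:R
    = (n.+1%:R - k%:R) * 'C(n.+1 + k, 2 * k)%:R :> int.
  have -> : 2 * k%:R + 1 = ((2 * k).+1)%:R :> int by ring.
  rewrite -natrM mul_bin_left natrM; have [le_kn | lt_nk] := leqP k n.+1.
    by congr (_ * _); rewrite -natrB //; congr _%:R; lia.
  by rewrite ['C(_, _)]bin_small ?mulr0 //; lia.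
have coefE m l : coefs (legendre m) l
    = (- 432) ^+ l * ('C(m + l, 2 * l) * 'C(2 * l, l))%:R by [].
rewrite !coefE bin1; have := central_binS k; move: bin2 {bin1 coefE}.
move: ('C(n.+1 + k, (2 * k).+1)) ('C(n.+1 + k, 2 * k)) ('C(n + k.+1, 2 * k.+1))
  ('C(2 * k.+1, k.+1)) ('C(2 * k, k)) => a b c d e ab.
move=> /(congr1 (fun m => m%:R : int)) /= de.
rewrite exprS; by apply: (linear_comb2 (k1 := - 864 * (- 432) ^+ k * e%:R)
  (k2 := - 432 * (- 432) ^+ k * a%:R) ab de); ring.
Qed.

Local Notation X := (1 - 864 * fps_q int).

Lemma X_mul (x : {fps int}) : X * fps_deriv x = fps_deriv x - 864 * fps_delta x.
Proof. by rewrite delta_deriv; ring. Qed.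

(** The classical X P_(n+1)' - P_n' = (n + 1) P_(n+1); the factor -864 is dX/dq. *)
Lemma legendre_deriv1 n :
  X * fps_deriv (legendre n.+1) - fps_deriv (legendre n)
    = - (864 * n.+1%:R * legendre n.+1).
Proof.
rewrite X_mul; apply: fpsP => k.
rewrite !coefsB coefsN -natrM !coefs_natM !coefs_deriv coefs_delta natrM.
by apply: (linear_comb (k := 1) (legendre_deriv_sub n k)); ring.
Qed.

Lemma legendre_deriv2 n :
  X * fps_deriv (legendre n) - fps_deriv (legendre n.+1)
    = 864 * n.+1%:R * legendre n.
Proof.
rewrite X_mul; apply: fpsP => k.
rewrite !coefsB -natrM !coefs_natM !coefs_deriv coefs_delta natrM.
by apply: (linear_comb2 (k1 := - 1) (k2 := 864) (legendre_deriv_sub n k)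
  (legendre_bin_neighbour n k)); ring.
Qed.

Lemma deriv_X : fps_deriv X = - 864.
Proof. by rewrite fps_derivB fps_deriv1 fps_deriv_natM deriv_q mulr1 sub0r. Qed.

Lemma legendre0 : legendre 0 = 1.
Proof.
apply: fpsP => -[|k] //.
by rewrite [LHS]/= [('C(_, _))]bin_small ?mul0n ?mulr0 //; lia.
Qed.

Lemma legendre_sqr_antideriv n :
  exists K, fps_deriv K = (864 * (2 * n + 1))%:R * legendre n ^+ 2.
Proof.
elim: n => [|n [K dK]].
  by exists (864 * fps_q int); rewrite fps_deriv_natM deriv_q legendre0; ring.
(* With integrals in X, (2n + 3) times that of P_(n+1)^2 exceeds (2n + 1) times that of P_n^2 by X
   (P_(n+1)^2 + P_n^2) - 2 P_(n+1) P_n; the outer sign comes from dX = -864 dq. *)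
exists (K - (X * (legendre n.+1 ^+ 2 + legendre n ^+ 2)
             - 2 * (legendre n.+1 * legendre n))).
rewrite !fps_derivB fps_deriv_natM !fps_derivM [fps_deriv (_ ^+ 2 + _)]fps_derivD.
rewrite !derivX2 deriv_X dK.
by apply: (linear_comb2 (k1 := - 2 * legendre n.+1) (k2 := - 2 * legendre n)
  (legendre_deriv1 n) (legendre_deriv2 n)); ring.
Qed.

Lemma X_mulV : X * X^-1 = 1.
Proof. by rewrite mulrV // fps_unitE coefsB coefs_natM mulr0 subr0. Qed.

Lemma deriv_Xinv : fps_deriv X^-1 = 864 * X^-1 ^+ 2.
Proof.
apply: fps_qI; rewrite -delta_deriv delta_invr; last first.
  by rewrite fps_unitE coefsB coefs_natM mulr0 subr0.
by rewrite delta_deriv deriv_X; ring.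
Qed.

Lemma legendre_sqr_div_antideriv n :
  exists K, fps_deriv K = 864 * (legendre n ^+ 2 * X^-1 ^+ 2).
Proof.
elim: n => [|n [K dK]].
  by exists X^-1; rewrite deriv_Xinv legendre0; ring.
(* Here the sum of two consecutive antiderivatives is explicit, so no denominator accumulates. *)
exists ((legendre n.+1 ^+ 2 + legendre n ^+ 2) * X^-1
        - 2 * (legendre n.+1 * legendre n) - K).
rewrite !fps_derivB fps_deriv_natM [fps_deriv (_ * X^-1)]fps_derivM fps_derivD !derivX2.
rewrite fps_derivM deriv_Xinv dK.
have wronskian : legendre n * (X * fps_deriv (legendre n.+1) - fps_deriv (legendre n))
    + legendre n.+1 * (X * fps_deriv (legendre n) - fps_deriv (legendre n.+1)) = 0.
  by rewrite legendre_deriv1 legendre_deriv2; ring.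
by apply: (linear_comb2 (k1 := - 2 * X^-1) (k2 := 2 * (fps_deriv (legendre n.+1)
  * legendre n + legendre n.+1 * fps_deriv (legendre n))) wronskian X_mulV); ring.
Qed.

(** * Bounding the denominators *)

Lemma scaled_dvd_Xinv : scaled_dvd 1 X^-1.
Proof.
have -> : X^-1 = Fps (fun n => 864 ^+ n).
  have UX : X \is a GRing.unit by rewrite fps_unitE coefsB coefs_natM mulr0 subr0.
  apply: (mulrI UX); rewrite mulrV //; apply: fpsP => n.
  rewrite mulrBl mul1r coefsB -mulrA coefs_natM; case: n => [|n].
    by rewrite coefs_qM0 mulr0 subr0.
  by rewrite coefs_qMS -exprS subrr.
move=> n; rewrite mul1r dvdz_mull //; apply/dvdzP; exists (72 ^+ n).
by rewrite -exprMn.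
Qed.

(** Each factor (6i + 1)(6i + 5) is -1 modulo 6, so squaring is what guarantees the residue 1. *)
Lemma hyp_num_sqr k : exists n, 6 * n%:R + 1 = (hyp_num k)%:R ^+ 2 :> int.
Proof.
elim: k => [|k [n IHk]]; first by exists 0%N; rewrite /hyp_num big_ord0.
exists (n * ((6 * k + 1) * (6 * k + 5)) ^ 2
  + 6 * (6 * k ^ 2 + 6 * k) ^ 2 + 10 * (6 * k ^ 2 + 6 * k) + 4)%N.
rewrite /hyp_num big_ord_recr -/(hyp_num k) /= natrM exprMn -IHk; ring.
Qed.

(** By [hyp_coefE], ((n + 1)!)^2 divides 12^(n + 1) U for U = [hyp_num n.+1]; using n + 1 rather
    than n leaves the factor n + 1 needed to integrate. *)
Lemma dvdz_of_scaled_dvd d f n : scaled_dvd d f ->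
  (n.+1%:R * d %| 12 * (hyp_num n.+1)%:R * coefs f n)%Z.
Proof.
move=> /(_ n) /dvdzP[z fz]; apply/dvdzP; exists (n.+1%:R * z * (hyp_coef n.+1)%:R).
have F_neq0 : (n.+1)`!%:R ^+ 2 != 0 :> int.
  by rewrite expf_neq0 // pnatr_eq0 -lt0n fact_gt0.
apply: (mulfI F_neq0).
have := congr1 (fun m => m%:R : int) (hyp_coefE n.+1).
move: (hyp_num _) (hyp_coef _) => U h /=.
rewrite natrM natrX natrM natrX [12 ^+ _]exprS factS natrM => hU.
by apply: (linear_comb2 (k1 := 12 * U%:R * n.+1%:R ^+ 2)
  (k2 := - n.+1%:R ^+ 2 * d * z) fz hU); ring.
Qed.

Lemma antideriv_of_dvd (f : {fps int}) :
  (forall n, (n.+1%:R %| coefs f n)%Z) -> exists K, fps_deriv K = f.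
Proof.
move=> f_dvd; exists (Fps (fun n => (coefs f n.-1 %/ n%:R)%Z)).
by apply: fpsP => n; rewrite coefs_deriv mulrC divzK.
Qed.

(* [U = hyp_num n.+1] is prime to 6 and [(n + 1)`! ^ 2] divides [12 ^ (n + 1) * U]
   by [hyp_coefE]; the coefficients of degree [n] are compared with those of
   [legendre M] for [6 * M + 1 = U ^ 2]. *)
Lemma hyp_sqr_antideriv (u : {fps int}) :
    scaled_dvd 1 u ->
    (forall n, exists K,
       fps_deriv K = (864 * (2 * n + 1))%:R * (legendre n ^+ 2 * u)) ->
  exists K, fps_deriv K = 20736 * (hyp_series ^+ 2 * u).
Proof.
move=> u1 leg_u; apply: antideriv_of_dvd => n.
have [M hM] := hyp_num_sqr n.+1; have [K dK] := leg_u M.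
have G1 := scaled_dvd_hyp; have A1 := scaled_dvd_legendre M.
have := dvdz_of_scaled_dvd n (scaled_dvdM
  (scaled_dvdM (scaled_dvd_hyp_legendre M) (scaled_dvdD G1 A1)) u1).
have := dvdz_of_scaled_dvd n (scaled_dvdM (scaled_dvdM G1 G1) u1).
(* The difference of squares inherits the divisor 6M + 1 = U^2 from its first factor. *)
have -> : (hyp_series - legendre M) * (hyp_series + legendre M) * u
  = hyp_series ^+ 2 * u - legendre M ^+ 2 * u by ring.
rewrite -expr2 !mulr1 hM coefsB coefs_natM.
have : coefs (fps_deriv K) n = coefs ((864 * (2 * M + 1))%:R * (legendre M ^+ 2 * u)) n.
  by rewrite dK.
rewrite coefs_deriv coefs_natM natrM natrD natrM.
move: (coefs K _) (coefs (hyp_series ^+ 2 * u) n) (coefs (legendre M ^+ 2 * u) n).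
have U_neq0 : (hyp_num n.+1)%:R != 0 :> int.
  rewrite pnatr_eq0 -lt0n prodn_gt0 // => i; rewrite muln_gt0; lia.
move: (hyp_num n.+1) hM U_neq0 => U hM U_neq0 k b a ak /dvdzP[z bz] /dvdzP[z' abz].
have {}abz : 12 * (b - a) = z' * n.+1%:R * U%:R.
  by apply: (mulfI U_neq0); apply: (linear_comb (k := 1) abz); ring.
(* Modulo n + 1, the equations [ak] and [abz] give 12 * 864 (6M + 3) b = 0. As 6M + 3 = U^2 + 2 and
   12 U b = 0, there remains 2 * 12 * 864 b = 20736 b = 0. *)
apply/dvdzP; exists (36 * k + 864 * (6 * M%:R + 3) * z' * U%:R - 864 * U%:R * z).
apply: (linear_comb2 (k1 := - 10368 * b) (k2 := - 36) hM ak).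
apply: (linear_comb2 (k1 := 864 * (6 * M%:R + 3)) (k2 := - 864 * U%:R) abz bz).
by ring.
Qed.

(** Up to an integer multiple, [v] is a multiple of E4 modulo exact derivatives. The E4 term
    accounts for the constant term, which single monomials do have. *)
Definition tame (v : {fps int}) :=
  exists (N : nat) (r : int) (w : {fps int}),
    (0 < N)%N /\ N%:R * v = r%:~R * E4 + fps_delta w.

Lemma tame_E4 : tame E4.
Proof. by exists 1%N, 1, 0; rewrite raddf0 addr0. Qed.

Lemma tame_delta w : tame (fps_delta w).
Proof. by exists 1%N, 0, w; rewrite mul1r mul0r add0r. Qed.

Lemma tame_intM (m : int) v : tame v -> tame (m%:~R * v).
Proof.
move=> [N [r [w [N_gt0 Nv]]]]; exists N, (m * r), (m%:~R * w); split=> //.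
by rewrite delta_intM; apply: (linear_comb (k := m%:~R) Nv); ring.
Qed.

Lemma tameD u v : tame u -> tame v -> tame (u + v).
Proof.
move=> [N [r [w [N_gt0 Nu]]]] [N' [r' [w' [N'_gt0 N'v]]]].
exists (N * N')%N, (N'%:R * r + N%:R * r'), (N'%:R * w + N%:R * w'); split.
  by rewrite muln_gt0 N_gt0.
rewrite deltaD !delta_natM.
by apply: (linear_comb2 (k1 := N'%:R) (k2 := N%:R) Nu N'v); ring.
Qed.

Lemma tame_natI N v : (0 < N)%N -> tame (N%:R * v) -> tame v.
Proof.
move=> N_gt0 [N' [r [w [N'_gt0 Nv]]]]; exists (N' * N)%N, r, w; split.
  by rewrite muln_gt0 N'_gt0.
by rewrite -Nv; ring.
Qed.

Lemma tame_intI (m : int) v : m != 0 -> tame (m%:~R * v) -> tame v.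
Proof.
move=> m_neq0 mv; apply: (@tame_natI (absz m)); first by rewrite absz_gt0.
rewrite -[_%:R]/((Posz (absz m))%:~R) abszEsg rmorphM /= -mulrA.
exact: tame_intM.
Qed.

Lemma comp_inv_X y : coefs y 0 = 0 ->
  (1 - 864 * y) * fps_comp X^-1 y = 1.
Proof.
move=> y0; have <- : fps_comp X y = 1 - 864 * y.
  rewrite compB comp1 // comp_natM; congr (1 - 864 * _).
  by rewrite -[fps_q int]mulr1 comp_qM // comp1 // mulr1.
by rewrite -compM // X_mulV comp1.
Qed.

(** Both forms are f(y) dy with f = G^2 or G^2 / X^2; by the chain rule an integral antiderivative
    of 20736 f, composed with y, is one in q. *)
Lemma tame_disc : exists D,
  [/\ 1728 * D = E4 ^+ 3 - E6 ^+ 2, tame (D * E4^-1 ^+ 2)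
    & tame (E4 * D * E6^-1 ^+ 2)].
Proof.
have [D [y [D_def y0 Fa Fb]]] := modular_parametrization hyp_series0 hyp_series_ode.
have tame_comp f : (exists K, fps_deriv K = 20736 * f) ->
    tame (fps_comp f y * fps_delta y).
  move=> [K dK]; apply: (@tame_natI (144 * 144)%N) => //.
  have -> : (144 * 144)%:R * (fps_comp f y * fps_delta y) = fps_delta (fps_comp K y).
    by rewrite delta_comp // dK comp_natM; ring.
  exact: tame_delta.
exists D; split=> //.
  rewrite Fa -[hyp_series ^+ 2]mulr1; apply/tame_comp/hyp_sqr_antideriv.
    by case=> [|n]; rewrite coefs1 ?mulr0 ?dvdz0.
  by move=> n; rewrite mulr1; apply: legendre_sqr_antideriv.
have -> : E4 * D * E6^-1 ^+ 2
    = fps_comp (hyp_series ^+ 2 * X^-1 ^+ 2) y * fps_delta y.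
  rewrite compM // [fps_comp (X^-1 ^+ 2) y]compM //.
  have := comp_inv_X y0; move: (fps_comp X^-1 y) => z sz.
  apply: (linear_comb2 (k1 := z ^+ 2)
    (k2 := - E4 * D * E6^-1 ^+ 2 * ((1 - 864 * y) * z + 1)) Fb sz); ring.
apply/tame_comp/hyp_sqr_antideriv.
  by have := scaled_dvdM scaled_dvd_Xinv scaled_dvd_Xinv; rewrite mulr1 -expr2.
move=> n; have [K dK] := legendre_sqr_div_antideriv n.
exists ((2 * n + 1)%:R * K); rewrite fps_deriv_natM dK.
by rewrite natrM; ring.
Qed.

(** * Reduction of the elements of weight 4 *)

Lemma delta_exprz (u : {fps int}) (b : int) : u \is a GRing.unit ->
  fps_delta (u ^ b) * u = b%:~R * u ^ b * fps_delta u.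
Proof.
move=> Uu; have deltaX v n : fps_delta (v ^+ n) * v = n%:R * v ^+ n * fps_delta v :> {fps int}.
  elim: n => [|n IHn]; first by rewrite delta1 !mul0r.
  by rewrite exprS deltaM; apply: (linear_comb (k := v) IHn); ring.
case: b => n; first exact: deltaX.
rewrite NegzE -exprz_inv -[(u^-1) ^ _]/(u^-1 ^+ n.+1).
have uV := mulrV Uu; have := deltaX u^-1 n.+1; rewrite (delta_invr Uu) mulrNz.
move: (u^-1) uV (fps_delta _) => v uV dvn dv.
have -> : dvn * u = dvn * v * u ^+ 2 + dvn * u * (1 - u * v) by ring.
rewrite dv uV subrr mulr0 addr0.
have -> : n.+1%:R * v ^+ n.+1 * (- fps_delta u * v ^+ 2) * u ^+ 2
  = - (n.+1%:R * v ^+ n.+1 * fps_delta u * (u * v) ^+ 2) by ring.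
by rewrite uV expr1n mulr1 !mulNr.
Qed.

Definition eis_mono (b c : int) : {fps int} := E4 ^ b * E6 ^ c.

Section Monomials.

Local Notation r := (E6 * E4^-1).
Local Notation s := (E4 ^+ 2 * E6^-1).

Lemma mulE4V : E4 * E4^-1 = 1. Proof. by rewrite mulrV ?E4_unit. Qed.
Lemma mulE6V : E6 * E6^-1 = 1. Proof. by rewrite mulrV ?E6_unit. Qed.

Lemma delta_mono b c :
  6 * fps_delta (eis_mono b c)
    = eis_mono b c * (2 * b%:~R * (E2 - r) + 3 * c%:~R * (E2 - s)).
Proof.
have d4 : 3 * fps_delta (E4 ^ b) = b%:~R * E4 ^ b * (E2 - r).
  apply: (mulIr E4_unit); have := delta_exprz b E4_unit.
  move: (E4^-1) mulE4V (fps_delta (E4 ^ b)) (E4 ^ b) => i Hi dx x dxE.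
  apply: (linear_comb2 (k1 := 3) (k2 := b%:~R * x) dxE delta_E4).
  by apply: (linear_comb (k := b%:~R * x * E6) Hi); ring.
have d6 : 2 * fps_delta (E6 ^ c) = c%:~R * E6 ^ c * (E2 - s).
  apply: (mulIr E6_unit); have := delta_exprz c E6_unit.
  move: (E6^-1) mulE6V (fps_delta (E6 ^ c)) (E6 ^ c) => i Hi dx x dxE.
  apply: (linear_comb2 (k1 := 2) (k2 := c%:~R * x) dxE delta_E6).
  by apply: (linear_comb (k := c%:~R * x * E4 ^+ 2) Hi); ring.
rewrite deltaM; move: d4 d6; rewrite /eis_mono.
move: (fps_delta (E4 ^ b)) (fps_delta (E6 ^ c)) (E4 ^ b) (E6 ^ c) => dx dy x y d4 d6.
by apply: (linear_comb2 (k1 := 2 * y) (k2 := 3 * x) d4 d6); ring.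
Qed.

Lemma mono_shift b c (m n : nat) :
  eis_mono (b - m%:Z + 2 * n%:Z) (c + m%:Z - n%:Z) = eis_mono b c * r ^+ m * s ^+ n.
Proof.
rewrite /eis_mono !exprzDr ?E4_unit ?E6_unit // -!exprz_inv -PoszM -!exprnP.
by rewrite mul2n -addnn exprD !exprMn; ring.
Qed.

Lemma mono_r b c : eis_mono (b - 1) (c + 1) = eis_mono b c * r.
Proof.
have := mono_shift b c 1 0; rewrite mulr0 addr0 subr0 => ->.
by rewrite expr1 mulr1.
Qed.

Lemma mono_s b c : eis_mono (b + 2) (c - 1) = eis_mono b c * s.
Proof.
have := mono_shift b c 0 1; rewrite mulr1 subr0 addr0 => ->.
by rewrite expr1 mulr1.
Qed.

Lemma delta_r : 6 * fps_delta r = r * (E2 + 2 * r - 3 * s).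
Proof.
have e : eis_mono (-1) 1 = r by rewrite /eis_mono mulrC.
by have := delta_mono (-1) 1; rewrite e => ->; ring.
Qed.

Lemma delta_s : 6 * fps_delta s = s * (E2 - 4 * r + 3 * s).
Proof.
have e : eis_mono 2 (-1) = s by [].
by have := delta_mono 2 (-1); rewrite e => ->; ring.
Qed.

Lemma mul_rs : r * s = E4.
Proof.
have -> : r * s = E4 * (E4 * E4^-1) * (E6 * E6^-1) by ring.
by rewrite mulE4V mulE6V !mulr1.
Qed.

Lemma delta_E2_rs : 12 * fps_delta E2 = E2 ^+ 2 - r * s.
Proof. by rewrite mul_rs delta_E2. Qed.

(** E4 (E4^3 / E6^2)^m; these are all the weight 4 monomials in E4 and E6 alone. *)
Definition tau (m : int) := eis_mono (1 + 3 * m) (- (2 * m)).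

Lemma tau_shift j (m n : nat) : (m + n)%N = 3 ->
  tau (j + n%:Z - 1) = eis_mono (1 + 3 * j) (- 1 - 2 * j) * r ^+ m * s ^+ n.
Proof. by move=> mn; rewrite -mono_shift /tau; congr eis_mono; lia. Qed.

Lemma tame_last (a b c d : int) u0 u1 u2 u3 (w : {fps int}) :
    d != 0 -> tame u0 -> tame u1 -> tame u2 ->
    fps_delta w = a%:~R * u0 + b%:~R * u1 + c%:~R * u2 + d%:~R * u3 -> tame u3.
Proof.
move=> d_neq0 t0 t1 t2 dw; apply: (tame_intI d_neq0).
have -> : d%:~R * u3 = fps_delta w + (- a)%:~R * u0 + (- b)%:~R * u1 + (- c)%:~R * u2.
  by rewrite dw; ring.
by do ?apply: tameD; [apply: tame_delta | apply: tame_intM..].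
Qed.

Lemma tame_first (a b c d : int) u0 u1 u2 u3 (w : {fps int}) :
    a != 0 -> tame u1 -> tame u2 -> tame u3 ->
    fps_delta w = a%:~R * u0 + b%:~R * u1 + c%:~R * u2 + d%:~R * u3 -> tame u0.
Proof.
move=> a_neq0 t1 t2 t3 dw; apply: (@tame_last b c d a u1 u2 u3 u0 w) => //.
by rewrite dw; ring.
Qed.

(* Bol's identity: the third derivative of a form of weight -2 is modular. *)
Lemma tau_recurrence (j : int) : exists w, fps_delta w =
  (96 * j - 864 * j ^+ 3)%:~R * tau (j - 1)
  + (276 + 1320 * j + 2592 * j ^+ 2 + 2592 * j ^+ 3)%:~R * tau j
  + (- 924 - 3792 * j - 5184 * j ^+ 2 - 2592 * j ^+ 3)%:~R * tau (j + 1)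
  + (648 + 2376 * j + 2592 * j ^+ 2 + 864 * j ^+ 3)%:~R * tau (j + 2).
Proof.
pose h := eis_mono (1 + 3 * j) (- 1 - 2 * j).
have -> : tau (j - 1) = h * r ^+ 3.
  by rewrite -[j]addr0 (@tau_shift j 3 0) // mulr1.
have -> : tau j = h * r ^+ 2 * s ^+ 1 by rewrite -tau_shift // addrK.
have -> : tau (j + 1) = h * r ^+ 1 * s ^+ 2 by rewrite -tau_shift //; congr tau; ring.
have -> : tau (j + 2) = h * s ^+ 3.
  have := @tau_shift j 0 3 erefl; rewrite expr0 mulr1 => <-; congr tau; ring.
have := delta_mono (1 + 3 * j) (- 1 - 2 * j); rewrite -/h.
have := delta_E2_rs; have := delta_s; have := delta_r.
move: E2 r s h => E x z h dx dz de dh.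
pose b : {fps int} := (1 + 3 * j)%:~R; pose c : {fps int} := (- 1 - 2 * j)%:~R.
have db : fps_delta b = 0 by apply: delta_int.
have dc : fps_delta c = 0 by apply: delta_int.
(* Since 2b + 3c = -1, the derivatives of h satisfy 6 h' = h P1 and 72 h'' = h P2, so the witness is
   864 h''. *)
pose P1 := - (E + 2 * b * x + 3 * c * z).
pose P2 := 2 * P1 ^+ 2 - (E ^+ 2 - x * z) - 4 * b * x * (E + 2 * x - 3 * z)
           - 6 * c * z * (E - 4 * x + 3 * z).
exists (12 * (h * P2)).
have -> : fps_delta (12 * (h * P2)) = 12 * (fps_delta h * P2 + h * fps_delta P2).
  by rewrite delta_natM deltaM.
have -> : fps_delta P2 =
    (- 4 * P1 - 2 * E - 4 * b * x - 6 * c * z) * fps_delta E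
    + (- 8 * b * P1 + z - 4 * b * (E + 2 * x - 3 * z) - 8 * b * x + 24 * c * z)
      * fps_delta x
    + (- 12 * c * P1 + x + 12 * b * x - 6 * c * (E - 4 * x + 3 * z) - 18 * c * z)
      * fps_delta z.
  rewrite /P2 /P1 !(delta_nat, db, dc, deltaB, deltaD, deltaN, deltaX2, deltaM).
  by ring.
apply: (linear_comb2 (k1 := 2 * P2)
  (k2 := h * (- 4 * P1 - 2 * E - 4 * b * x - 6 * c * z)) dh de).
apply: (linear_comb2
  (k1 := 2 * h * (- 8 * b * P1 + z - 4 * b * (E + 2 * x - 3 * z) - 8 * b * x + 24 * c * z))
  (k2 := 2 * h * (- 12 * c * P1 + x + 12 * b * x - 6 * c * (E - 4 * x + 3 * z) - 18 * c * z))
  dx dz).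
by rewrite /P2 /P1 /b /c; ring.
Qed.

(** Starting from m = -1, 0, 1, the recurrence is solved for its last term at j = n and for its
    first at j = -(n + 1). The leading coefficients 216 (j + 1)(2j + 1)(2j + 3) and 96 j (1 - 9 j^2)
    do not vanish there. *)
Lemma tame_tau m : tame (tau m).
Proof.
have tau0 : tame (tau 0) by rewrite /tau /eis_mono !mulr0 !addr0 oppr0 mulr1; apply: tame_E4.
have [D [D_def Fa Fb]] := tame_disc.
have tauN1 : tame (tau (-1)).
  have -> : tau (-1) = E4 + (- 1728)%:~R * (D * E4^-1 ^+ 2).
    have -> : tau (-1) = E4^-1 ^+ 2 * E6 ^+ 2 by rewrite exprVn.
    move: (E4^-1) mulE4V => i Hi.
    by apply: (linear_comb2 (k1 := i ^+ 2) (k2 := E4 * (E4 * i + 1)) D_def Hi); ring.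
  by apply: tameD tame_E4 _; apply: tame_intM.
have tau1 : tame (tau 1).
  have -> : tau 1 = E4 + 1728%:~R * (E4 * D * E6^-1 ^+ 2).
    have -> : tau 1 = E4 ^+ 4 * E6^-1 ^+ 2 by rewrite exprVn.
    move: (E6^-1) mulE6V => i Hi.
    by apply: (linear_comb2 (k1 := - E4 * i ^+ 2) (k2 := E4 * (E6 * i + 1)) D_def Hi); ring.
  by apply: tameD tame_E4 _; apply: tame_intM.
suff [] : tame (tau `|m|%:Z) /\ tame (tau (- `|m|%:Z)).
  by case: (intP m) => [|n|n] //; rewrite ?abszN //.
elim/ltn_ind: `|m|%N => -[|[|n]] IHn //.
have [tn tNn] := IHn n.+1 (leqnn _).
have [tn' tNn'] : tame (tau n) /\ tame (tau (- n%:Z)) by apply: IHn; lia.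
have [tn'' tNn''] : tame (tau (n%:Z - 1)) /\ tame (tau (1 - n%:Z)).
  case: n IHn tn tNn tn' tNn' => [|n] IHn *; first by rewrite sub0r subr0.
  have -> : n.+1%:Z - 1 = n by lia.
  have -> : 1 - n.+1%:Z = - n%:Z by lia.
  by apply: IHn; lia.
split.
  have [w dw] := tau_recurrence n%:Z.
  have e1 : n%:Z + 1 = n.+1%:Z by lia.
  have e2 : n%:Z + 2 = n.+2%:Z by lia.
  rewrite e1 e2 in dw.
  by apply: tame_last tn'' tn' tn dw; lia.
have [w dw] := tau_recurrence (- n.+1%:Z).
have e1 : - n.+1%:Z - 1 = - n.+2%:Z by lia.
have e2 : - n.+1%:Z + 1 = - n%:Z by lia.
have e3 : - n.+1%:Z + 2 = 1 - n%:Z by lia.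
rewrite -e1; apply: tame_first dw; rewrite ?e2 ?e3 //; nia.
Qed.

Lemma tame_mono b c : 2 * b + 3 * c = 2 -> tame (eis_mono b c).
Proof.
move=> w4; have := tame_tau (b + c - 1); rewrite /tau.
by congr (tame (eis_mono _ _)); lia.
Qed.

(** In the derivative of a weight 2 monomial f, E2 f has coefficient (2b + 3c)/6 = 1/6 and the rest
    is free of E2. *)
Lemma tame_E2_mono b c : 2 * b + 3 * c = 1 -> tame (E2 * eis_mono b c).
Proof.
move=> w2.
have -> : E2 * eis_mono b c = 6%:~R * fps_delta (eis_mono b c)
    + (2 * b)%:~R * eis_mono (b - 1) (c + 1) + (3 * c)%:~R * eis_mono (b + 2) (c - 1).
  rewrite mono_r mono_s -[6%:~R]/6 delta_mono.
  have c1 : 2 * b%:~R + 3 * c%:~R = 1 :> {fps int}.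
    by have := congr1 (fun m : int => m%:~R : {fps int}) w2; rewrite rmorphD !rmorphM.
  by apply: (linear_comb (k := - (E2 * eis_mono b c)) c1); ring.
do ?apply: tameD; do ?apply: tame_intM; [exact: tame_delta | |];
  apply: tame_mono; lia.
Qed.

(** For f of weight 0 the derivative of E2 f contains E2^2 f only through the derivative of E2, with
    coefficient 1/12; the other terms have lower degree in E2. *)
Lemma tame_E2sq_mono b c : 2 * b + 3 * c = 0 -> tame (E2 ^+ 2 * eis_mono b c).
Proof.
move=> w0.
have -> : E2 ^+ 2 * eis_mono b c = 12%:~R * fps_delta (E2 * eis_mono b c)
    + eis_mono (b + 1) c + (4 * b)%:~R * (E2 * eis_mono (b - 1) (c + 1))
    + (6 * c)%:~R * (E2 * eis_mono (b + 2) (c - 1)).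
  have -> : eis_mono (b + 1) c = eis_mono b c * (r * s).
    rewrite mul_rs /eis_mono exprzDr ?E4_unit // expr1z; ring.
  rewrite mono_r mono_s -[12%:~R]/12 deltaM.
  have c1 : 2 * b%:~R + 3 * c%:~R = 0 :> {fps int}.
    by have := congr1 (fun m : int => m%:~R : {fps int}) w0; rewrite rmorphD !rmorphM.
  apply: (linear_comb2 (k1 := - 2 * E2) (k2 := - eis_mono b c)
    (delta_mono b c) delta_E2_rs).
  by apply: (linear_comb (k := - 2 * (E2 ^+ 2 * eis_mono b c)) c1); ring.
do ?apply: tameD; do ?apply: tame_intM; [exact: tame_delta | | |].
- by apply: tame_mono; lia.
- by apply: tame_E2_mono; lia.
by apply: tame_E2_mono; lia.
Qed.

End Monomials.

Lemma tame_eis a b c : weight a b c = 4 -> a%:Z <= 4 - 2 -> tame (eis a b c).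
Proof.
rewrite /weight /eis -mulrA -/(eis_mono b c); case: a => [|[|[|a]]] wt le_a2.
- by rewrite expr0 mul1r; apply: tame_mono; lia.
- by rewrite expr1; apply: tame_E2_mono; lia.
- by apply: tame_E2sq_mono; lia.
by exfalso; lia.
Qed.

(** * Rational combinations and the conclusion *)

Lemma fpsQD (x y : {fps int}) : fpsQ (x + y) = fpsQ x + fpsQ y.
Proof. by apply: fpsP => n; rewrite /= rmorphD. Qed.

Lemma fpsQ_intM (m : int) (x : {fps int}) : fpsQ (m%:~R * x) = m%:~R *: fpsQ x.
Proof.
by apply: fpsP => n; rewrite mulrzl -scaler_int coefsZ intz /= rmorphM.
Qed.

Lemma V4_tame v : V 4 v -> exists (N : int) (r : int) (w : {fps int}),
  0 < N /\ N%:~R *: v = fpsQ (r%:~R * E4 + fps_delta w).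
Proof.
case=> t; elim: t v => [|[x u] t IHt] v Vt ->.
  by exists 1, 0, 0; split=> //; rewrite big_nil scaler0 mul0r add0r raddf0; apply: fpsP.
have [|N [p [w [N_gt0 Nt]]]] := IHt _ _ erefl.
  by move=> y ty; apply: Vt; rewrite inE ty orbT.
have [/= a [b [c [wt le_a2 u_def]]]] := Vt (x, u) (mem_head _ _).
have [N' [p' [w' [N'_gt0 Nu]]]] := tame_eis wt le_a2.
(* The product of both multipliers and the denominator of the new scalar clears the whole sum. *)
exists (N * (denq x * N'%:Z)), (denq x * N'%:Z * p + N * numq x * p'),
  ((denq x * N'%:Z)%:~R * w + (N * numq x)%:~R * w'); split.
  by rewrite mulr_gt0 // mulr_gt0 ?denq_gt0 // ltz_nat.
have -> : (denq x * N'%:Z * p + N * numq x * p')%:~R * E4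
    + fps_delta ((denq x * N'%:Z)%:~R * w + (N * numq x)%:~R * w')
  = (denq x * N'%:Z)%:~R * (p%:~R * E4 + fps_delta w)
    + (N * numq x)%:~R * (N'%:R * eis a b c).
  by rewrite Nu deltaD !delta_intM; ring.
rewrite fpsQD !fpsQ_intM -Nt big_cons /= u_def -[N'%:R]/(N'%:Z%:~R) fpsQ_intM.
rewrite scalerDr !scalerA addrC; congr (_ *: _ + _ *: _).
  by rewrite !rmorphM /=; ring.
by rewrite !rmorphM /= numqE; ring.
Qed.

Theorem theorem3 (v : {fps rat}) (hv : V0 4 v) : magnetic v.
Proof.
case: hv => /V4_tame [N [r [w [N_gt0 Nv]]]] [_ /= v0].
(* Compare constant terms: [v] and a derivative have none, E4 has 1. *)
have r0 : r = 0.
  have : coefs (N%:~R *: v) 0 = coefs (fpsQ (r%:~R * E4 + fps_delta w)) 0 by rewrite Nv.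
  rewrite coefsZ v0 mulr0 fpsQD fpsQ_intM coefsD coefsZ => /esym/eqP.
  have -> : coefs (fpsQ E4) 0 = 1 by rewrite -[LHS]/((coefs E4 0)%:~R) coefsE40.
  have -> : coefs (fpsQ (fps_delta w)) 0 = 0 by rewrite /= mul0r.
  by rewrite mulr1 addr0 intr_eq0 => /eqP.
(* The integral witness is [w] stripped of its constant term, which differentiation had erased. *)
exists N => //; exists (Fps (fun n => if n == 0%N then 0 else coefs w n)) => //.
apply: fpsP => -[|n]; first by rewrite coefsZ mulr0.
have : coefs (N%:~R *: v) n.+1 = coefs (fpsQ (r%:~R * E4 + fps_delta w)) n.+1 by rewrite Nv.
rewrite r0 mul0r add0r !coefsZ => Nvn.
have n_neq0 : n.+1%:R != 0 :> rat by rewrite pnatr_eq0.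
apply: (mulIf n_neq0); rewrite [coefs (delta_inv v) _]/= mulrA divfK // Nvn.
transitivity ((n.+1%:R * coefs w n.+1)%:~R : rat); first by [].
by rewrite intrM natz -pmulrn mulrC.
Qed.
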